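(* Consider the linear closed-loop system with states $\delta_i''\in\mathbb{R}^{n_i-1}$, $\hat\omega_i\in\mathbb{R}^{n_i}$ ($i=1,\dots,n$), $\hat V\in\mathbb{R}^n$, $\eta\in\mathbb{R}^n$, $\phi''\in\mathbb{R}^{n-1}$ given by $$\begin{aligned} \dot\delta_i'' &= S_i^T\hat\omega_i,\qquad i=1,\dots,n,\\ \dot{\hat\omega}_i &= M_i\Big(-(K_i^{\mathrm{droop}}+K_i^\omega)\hat\omega_i+e_1K_i^V\hat V_i-\mathcal{L}_i^{\mathrm{AC}}S_i\delta_i''-\frac{K_i^V}{K_{i_1}^\omega}K_i^{\mathrm{droop,I}}1_{n_i}\eta_i-e_1e_i^T\mathcal{L}_\phi S\phi''+P_i^m\Big),\quad i=1,\dots,n,\\ \dot{\hat V} &= \frac{1}{V^{\mathrm{nom}}}E\tilde K^\omega\tilde\omega-E\Big(\mathcal{L}_R+\frac{K^V}{V^{\mathrm{nom}}}\Big)\hat V+\frac{1}{V^{\mathrm{nom}}}E\mathcal{L}_\phi S\phi'',\\ \dot\eta &= \sum_{i=1}^n e_i1_{n_i}^TK_i^{\mathrm{droop,I}}\hat\omega_i-\mathcal{L}_\eta\eta,\\ \dot\phi'' &= S^T(K^V)^{-1}\tilde K^\omega\tilde\omega-\gamma\phi''. \end{aligned}$$ Suppose that $\mathcal{L}_\phi=k_\phi\mathcal{L}_R$ for a constant $k_\phi$, and that $\gamma>k_\phi/(4V^{\mathrm{nom}})$. Then the equilibrium of this system is globally asymptotically stable.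
   Context: The system models $n$ HVDC converters, converter $i$ being connected to bus $i_1$ of an AC grid with $n_i$ generator buses $i_1,\dots,i_{n_i}$. $\hat\omega_i=[\hat\omega_{i_1},\dots,\hat\omega_{i_{n_i}}]^T$ and $\tilde\omega=[\hat\omega_{1_1},\dots,\hat\omega_{n_1}]^T$ collects the frequency deviations at the converter buses. $M_i=\mathrm{diag}(m_{i_1}^{-1},\dots,m_{i_{n_i}}^{-1})$ with $m_{i_k}>0$; $K_i^{\mathrm{droop}}=\mathrm{diag}(K_{i_1}^{\mathrm{droop}},\dots,K_{i_{n_i}}^{\mathrm{droop}})$ and $K_i^{\mathrm{droop,I}}=\mathrm{diag}(K_{i_1}^{\mathrm{droop,I}},\dots,K_{i_{n_i}}^{\mathrm{droop,I}})$ with positive diagonal entries; $K_i^\omega=\mathrm{diag}(K_{i_1}^\omega,0,\dots,0)\in\mathbb{R}^{n_i\times n_i}$ with $K_{i_1}^\omega>0$; $\tilde K^\omega=\mathrm{diag}(K_{1_1}^\omega,\dots,K_{n_1}^\omega)$; $K^V=\mathrm{diag}(K_1^V,\dots,K_n^V)$ with $K_i^V>0$. $P_i^m\in\mathbb{R}^{n_i}$ is constant. $E=\mathrm{diag}(C_1^{-1},\dots,C_n^{-1})$ with $C_i>0$, and $V^{\mathrm{nom}}>0$. $\mathcal{L}_i^{\mathrm{AC}}$ is the weighted Laplacian (positive edge weights $k_{i_kj}$) of the connected undirected graph of AC grid $i$. $\mathcal{L}_R$ is the weighted Laplacian of the connected undirected graph of the MTDC (multi-terminal HVDC) grid on $1,\dots,n$,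 with edge weights $1/R_{ij}>0$. $\mathcal{L}_\eta$ and $\mathcal{L}_\phi$ are weighted Laplacians of undirected communication graphs on $1,\dots,n$ with edge weights $c^\eta_{ij}=c^\eta_{ji}>0$ and $c^\phi_{ij}=c^\phi_{ji}>0$. $e_i$ is the $i$th standard unit vector (of the appropriate dimension), $1_k$ the all-ones vector in $\mathbb{R}^k$. $S$ is an $n\times(n-1)$ matrix such that $[\tfrac{1}{\sqrt n}1_n\;\;S]$ is orthogonal, and $S_i$ is an $n_i\times(n_i-1)$ matrix such that $[\tfrac{1}{\sqrt{n_i}}1_{n_i}\;\;S_i]$ is orthogonal. *)

(* Defs.v *)
From HB Require Import structures.
From mathcomp Require Import all_boot all_order all_algebra.
From mathcomp Require Import all_classical all_reals all_analysis.
Set Implicit Arguments.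
Unset Strict Implicit.
Unset Printing Implicit Defensive.
Import Order.TTheory GRing.Theory Num.Theory.
Import numFieldNormedType.Exports.
Local Open Scope classical_set_scope.
Local Open Scope ring_scope.

Section Autonomous_ODE.
Variables (R : realType) (X : normedModType R).
Implicit Types (f : X -> X) (x : R -> X) (xe : X).

(* Classical solutions of x' = f x on [0, +oo[; the values of x at negative
   times are irrelevant. *)
Definition solution f x : Prop :=
  {within `[0, +oo[, continuous x} /\
  forall t : R, 0 < t -> is_derive t 1 x (f (x t)).

Definition equilibrium f xe : Prop := f xe = 0.

Definition lyapunov_stable f xe : Prop :=
  forall eps : R, 0 < eps -> exists2 delta : R, 0 < delta &
    forall x, solution f x -> `|x 0 - xe| < delta ->
    forall t : R, 0 <= t -> `|x t - xe| < eps.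

Definition globally_attractive f xe : Prop :=
  forall x, solution f x -> x t @[t --> +oo] --> xe.

Definition globally_asymptotically_stable f xe : Prop :=
  lyapunov_stable f xe /\ globally_attractive f xe.

End Autonomous_ODE.

Section Graphs.
Variables (R : realType) (n : nat).
Implicit Types (e : rel 'I_n) (w : 'I_n -> 'I_n -> R).

(* A simple undirected graph with positive symmetric edge labels; labels of
   non-edges are irrelevant. *)
Definition weighted_graph e w : Prop :=
  [/\ symmetric e, irreflexive e &
      forall i j, e i j -> 0 < w i j /\ w i j = w j i].

Definition connected_graph e : Prop := forall i j, connect e i j.

Definition laplacian e w : 'M[R]_n :=
  \matrix_(i, j) if i == j then \sum_(k < n | e i k) w i k
                 else if e i j then - w i j else 0.

End Graphs.

Definition ones {R : realType} (n : nat) : 'cV[R]_n := const_mx 1.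

Definition unit_vec {R : realType} (n : nat) (i : 'I_n) : 'cV[R]_n :=
  delta_mx i 0.

Definition diag_of {R : realType} (n : nat) (a : 'I_n -> R) : 'M[R]_n :=
  diag_mx (\row_i a i).

Definition orthogonal_matrix {R : realType} (n : nat) (Q : 'M[R]_n) : Prop :=
  Q^T *m Q = 1%:M.

(* The square matrix [ 1/sqrt(n+1) 1_(n+1)  S ]. *)
Definition extend_by_ones {R : realType} (n : nat) (S : 'M[R]_(n.+1, n)) :
    'M[R]_n.+1 :=
  row_mx ((Num.sqrt n.+1%:R)^-1 *: ones n.+1) S.

Unset Implicit Arguments.

(* There are N.+1 converters and AC grid i has (d i).+1 buses, so that the
   reduced coordinates have dimensions N and d i. Bus i_1 is ord0 : 'I_(d i).+1. *)
Record hvdc (R : realType) (N : nat) (d : 'I_N.+1 -> nat) := Hvdc {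
  inertia : forall i, 'I_(d i).+1 -> R;
  inertia_gt0 : forall i k, 0 < inertia i k;
  droop : forall i, 'I_(d i).+1 -> R;
  droop_gt0 : forall i k, 0 < droop i k;
  droopI : forall i, 'I_(d i).+1 -> R;
  droopI_gt0 : forall i k, 0 < droopI i k;
  Komega : 'I_N.+1 -> R;
  Komega_gt0 : forall i, 0 < Komega i;
  KVgain : 'I_N.+1 -> R;
  KVgain_gt0 : forall i, 0 < KVgain i;
  capacitance : 'I_N.+1 -> R;
  capacitance_gt0 : forall i, 0 < capacitance i;
  Vnom : R;
  Vnom_gt0 : 0 < Vnom;
  Pm : forall i, 'cV[R]_(d i).+1;
  ac_edge : forall i, rel 'I_(d i).+1;
  ac_weight : forall i, 'I_(d i).+1 -> 'I_(d i).+1 -> R;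
  ac_graph : forall i, weighted_graph (ac_edge i) (ac_weight i);
  ac_connected : forall i, connected_graph (ac_edge i);
  dc_edge : rel 'I_N.+1;
  resistance : 'I_N.+1 -> 'I_N.+1 -> R;
  dc_graph : weighted_graph dc_edge resistance;
  dc_connected : connected_graph dc_edge;
  (* The two communication graphs need not be connected. *)
  eta_edge : rel 'I_N.+1;
  eta_weight : 'I_N.+1 -> 'I_N.+1 -> R;
  eta_graph : weighted_graph eta_edge eta_weight;
  phi_edge : rel 'I_N.+1;
  phi_weight : 'I_N.+1 -> 'I_N.+1 -> R;
  phi_graph : weighted_graph phi_edge phi_weight;
  Smx : 'M[R]_(N.+1, N);
  Smx_orthogonal : orthogonal_matrix (extend_by_ones Smx);
  Sac : forall i, 'M[R]_((d i).+1, d i);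
  Sac_orthogonal : forall i, orthogonal_matrix (extend_by_ones (Sac i))
}.

Set Implicit Arguments.
Arguments inertia {R N d} _.
Arguments inertia_gt0 {R N d} _.
Arguments droop {R N d} _.
Arguments droop_gt0 {R N d} _.
Arguments droopI {R N d} _.
Arguments droopI_gt0 {R N d} _.
Arguments Komega {R N d} _.
Arguments Komega_gt0 {R N d} _.
Arguments KVgain {R N d} _.
Arguments KVgain_gt0 {R N d} _.
Arguments capacitance {R N d} _.
Arguments capacitance_gt0 {R N d} _.
Arguments Vnom {R N d} _.
Arguments Vnom_gt0 {R N d} _.
Arguments Pm {R N d} _.
Arguments ac_edge {R N d} _.
Arguments ac_weight {R N d} _.
Arguments ac_graph {R N d} _.
Arguments ac_connected {R N d} _.
Arguments dc_edge {R N d} _.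
Arguments resistance {R N d} _.
Arguments dc_graph {R N d} _.
Arguments dc_connected {R N d} _.
Arguments eta_edge {R N d} _.
Arguments eta_weight {R N d} _.
Arguments eta_graph {R N d} _.
Arguments phi_edge {R N d} _.
Arguments phi_weight {R N d} _.
Arguments phi_graph {R N d} _.
Arguments Smx {R N d} _.
Arguments Smx_orthogonal {R N d} _.
Arguments Sac {R N d} _.
Arguments Sac_orthogonal {R N d} _.
Arguments hvdc R {N} d.
Arguments Hvdc {R N d}.

Section Closed_loop.
Variables (R : realType) (N : nat) (d : 'I_N.+1 -> nat) (H : hvdc R d).

Definition Mmx i : 'M[R]_((d i).+1) := diag_of (fun k => (inertia H i k)^-1).
Definition Kdroop i : 'M[R]_((d i).+1) := diag_of (droop H i).
Definition KdroopI i : 'M[R]_((d i).+1) := diag_of (droopI H i).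
Definition Komega_mx i : 'M[R]_((d i).+1) :=
  diag_of (fun k => if k == ord0 then Komega H i else 0).
Definition Komega_tilde : 'M[R]_N.+1 := diag_of (Komega H).
Definition KV : 'M[R]_N.+1 := diag_of (KVgain H).
Definition Emx : 'M[R]_N.+1 := diag_of (fun i => (capacitance H i)^-1).

Definition L_AC i : 'M[R]_((d i).+1) := laplacian (ac_edge H i) (ac_weight H i).
Definition L_R : 'M[R]_N.+1 :=
  laplacian (dc_edge H) (fun i j => (resistance H i j)^-1).
Definition L_eta : 'M[R]_N.+1 := laplacian (eta_edge H) (eta_weight H).
Definition L_phi : 'M[R]_N.+1 := laplacian (phi_edge H) (phi_weight H).

(* The state (delta'', omega, V, eta, phi'') is stacked into one real column
   vector. *)
Definition state_dim : nat :=
  (\sum_i d i + (\sum_i (d i).+1 + (N.+1 + (N.+1 + N))))%N.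

Definition pack (delta : forall i, 'cV[R]_(d i))
    (omega : forall i, 'cV[R]_(d i).+1) (V eta : 'cV[R]_N.+1)
    (phi : 'cV[R]_N) : 'cV[R]_state_dim :=
  col_mx (\mxcol_i delta i) (col_mx (\mxcol_i omega i)
    (col_mx V (col_mx eta phi))).

Definition delta_of (x : 'cV[R]_state_dim) i : 'cV[R]_(d i) :=
  submxcol (usubmx x) i.
Definition omega_of (x : 'cV[R]_state_dim) i : 'cV[R]_(d i).+1 :=
  submxcol (usubmx (dsubmx x)) i.
Definition V_of (x : 'cV[R]_state_dim) : 'cV[R]_N.+1 :=
  usubmx (dsubmx (dsubmx x)).
Definition eta_of (x : 'cV[R]_state_dim) : 'cV[R]_N.+1 :=
  usubmx (dsubmx (dsubmx (dsubmx x))).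
Definition phi_of (x : 'cV[R]_state_dim) : 'cV[R]_N :=
  dsubmx (dsubmx (dsubmx (dsubmx x))).

Definition omega_tilde (x : 'cV[R]_state_dim) : 'cV[R]_N.+1 :=
  \col_i omega_of x i ord0 0.

Definition delta_dot (x : 'cV[R]_state_dim) i : 'cV[R]_(d i) :=
  (Sac H i)^T *m omega_of x i.

Definition omega_dot (x : 'cV[R]_state_dim) i : 'cV[R]_(d i).+1 :=
  Mmx i *m (- (Kdroop i + Komega_mx i) *m omega_of x i
           + (KVgain H i * V_of x i 0) *: unit_vec ord0
           - L_AC i *m Sac H i *m delta_of x i
           - (KVgain H i / Komega H i * eta_of x i 0) *:
               (KdroopI i *m ones (d i).+1)
           - unit_vec ord0 *m (unit_vec i)^T *m L_phi *m Smx H *m phi_of x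
           + Pm H i).

Definition V_dot (x : 'cV[R]_state_dim) : 'cV[R]_N.+1 :=
  (Vnom H)^-1 *: (Emx *m Komega_tilde *m omega_tilde x)
  - Emx *m (L_R + (Vnom H)^-1 *: KV) *m V_of x
  + (Vnom H)^-1 *: (Emx *m L_phi *m Smx H *m phi_of x).

Definition eta_dot (x : 'cV[R]_state_dim) : 'cV[R]_N.+1 :=
  \sum_i (unit_vec i *m (ones (d i).+1)^T *m KdroopI i *m omega_of x i)
  - L_eta *m eta_of x.

Definition phi_dot (gamma : R) (x : 'cV[R]_state_dim) : 'cV[R]_N :=
  (Smx H)^T *m invmx KV *m Komega_tilde *m omega_tilde x - gamma *: phi_of x.

Definition closed_loop (gamma : R) (x : 'cV[R]_state_dim) : 'cV[R]_state_dim :=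
  pack (delta_dot x) (omega_dot x) (V_dot x) (eta_dot x) (phi_dot gamma x).

End Closed_loop.

(* Main.v *)
Require Import Defs.
From mathcomp Require Import all_boot all_order all_algebra.
From mathcomp Require Import all_classical all_reals all_analysis.
From mathcomp Require Import ring lra.
Set Implicit Arguments.
Unset Strict Implicit.
Unset Printing Implicit Defensive.
Import Order.TTheory GRing.Theory Num.Theory.
Import numFieldNormedType.Exports.
Local Open Scope ring_scope.

(* In coordinates centred at the equilibrium, with z = S phi'' and
   b_i = K_i1^omega / K_i^V, the storage function
     sum_i b_i (omega_i^T M_i^-1 omega_i + (S_i delta_i)^T L_i^AC (S_i delta_i))
     + V^nom V^T E^-1 V + eta^T eta + z^T L_phi z + eps |phi''|^2
   is positive definite and decreases at twice the rate
     sum_i b_i omega_i^T K_i^droop omega_i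
     + sum_i (K_i1^omega omega_i1 - K_i^V V_i)^2 / K_i^V
     + (V^nom V^T L_R V - V^T L_phi z + gamma z^T L_phi z) + eta^T L_eta eta
     + eps (gamma |phi''|^2 - z^T u),   u_i = b_i omega_i1.
   The third summand is nonnegative because L_phi = k_phi L_R and
   gamma > k_phi / (4 V^nom); the term in eps makes the storage function
   definite in phi'' even when k_phi = 0, and for small eps its cross term is
   absorbed by the droop. The rate vanishes only where omega, V and phi'' do,
   and if it also vanishes at the velocity then delta'' and eta vanish. This
   one-step observability lets a small cross term turn the storage function
   into a strict quadratic Lyapunov function, which gives exponential decay. *)

(** * Quadratic forms and strict Lyapunov functions *)

Section Dot.
Variable R : realType.
Implicit Types (n m : nat).

Definition dot n (u v : 'cV[R]_n) : R := \sum_i u i 0 * v i 0.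

Lemma dotC n (u v : 'cV[R]_n) : dot u v = dot v u.
Proof. by apply: eq_bigr => i _; rewrite mulrC. Qed.

Lemma dotDl n (u v w : 'cV[R]_n) : dot (u + v) w = dot u w + dot v w.
Proof. by rewrite -big_split; apply: eq_bigr => i _; rewrite mxE mulrDl. Qed.

Lemma dotDr n (u v w : 'cV[R]_n) : dot w (u + v) = dot w u + dot w v.
Proof. by rewrite !(dotC w) dotDl. Qed.

Lemma dotZl n a (u w : 'cV[R]_n) : dot (a *: u) w = a * dot u w.
Proof. by rewrite mulr_sumr; apply: eq_bigr => i _; rewrite mxE mulrA. Qed.

Lemma dotZr n a (u w : 'cV[R]_n) : dot w (a *: u) = a * dot w u.
Proof. by rewrite !(dotC w) dotZl. Qed.

Lemma dotNl n (u w : 'cV[R]_n) : dot (- u) w = - dot u w.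
Proof. by rewrite -scaleN1r dotZl mulN1r. Qed.

Lemma dotNr n (u w : 'cV[R]_n) : dot w (- u) = - dot w u.
Proof. by rewrite !(dotC w) dotNl. Qed.

Lemma dot0l n (w : 'cV[R]_n) : dot 0 w = 0.
Proof. by rewrite -(scale0r w) dotZl mul0r. Qed.

Lemma dot0r n (w : 'cV[R]_n) : dot w 0 = 0.
Proof. by rewrite dotC dot0l. Qed.

Lemma dot_mxE n (u v : 'cV[R]_n) : dot u v = (u^T *m v) 0 0.
Proof. by rewrite mxE; apply: eq_bigr => i _; rewrite mxE. Qed.

Lemma dot_mulmxl n m (M : 'M[R]_(m, n)) u v : dot (M *m u) v = dot u (M^T *m v).
Proof. by rewrite !dot_mxE trmx_mul mulmxA. Qed.

Lemma dot_mulmxr n m (M : 'M[R]_(m, n)) u v : dot v (M *m u) = dot (M^T *m v) u.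
Proof. by rewrite dotC dot_mulmxl dotC. Qed.

Lemma dot_unit_vec n (u : 'cV[R]_n) i : dot u (unit_vec i) = u i 0.
Proof.
rewrite /dot (bigD1 i) //= mxE !eqxx mulr1 big1 ?addr0 // => l li.
by rewrite mxE (negbTE li) mulr0.
Qed.

Lemma dot_sym_mx n (M : 'M[R]_n) u v : M^T = M -> dot u (M *m v) = dot v (M *m u).
Proof. by move=> sM; rewrite dot_mulmxr sM dotC. Qed.

Lemma dot_ge0 n (u : 'cV[R]_n) : 0 <= dot u u.
Proof. by apply: sumr_ge0 => i _; rewrite -expr2 sqr_ge0. Qed.

Lemma sqr_coord_le_dot n (u : 'cV[R]_n) i : u i 0 ^+ 2 <= dot u u.
Proof.
by rewrite /dot (bigD1 i) //= expr2 lerDl sumr_ge0 // => j _; rewrite -expr2 sqr_ge0.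
Qed.

Lemma dot_eq0 n (u : 'cV[R]_n) : dot u u = 0 -> u = 0.
Proof.
move=> u0; apply/colP => i; rewrite mxE; apply/eqP.
by rewrite -sqrf_eq0 eq_le sqr_ge0 andbT -u0 sqr_coord_le_dot.
Qed.

(** Both [|u + s v|^2] and [|u - s v|^2] are nonnegative; expand and divide by [s]. *)
Lemma young_dot n (u v : 'cV[R]_n) (s : R) : 0 < s ->
  2 * `|dot u v| <= s^-1 * dot u u + s * dot v v.
Proof.
move=> s0; have hp := dot_ge0 (u + s *: v); have hm := dot_ge0 (u - s *: v).
move: hp hm; rewrite !(dotDl, dotDr, dotNl, dotNr, dotZl, dotZr) (dotC v u) => hp hm.
rewrite -(ler_pM2l s0) mulrDr [X in _ <= X + _]mulrA mulfV ?gt_eqF // mul1r.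
by case: ger0P => _; lra.
Qed.

Lemma mulmx_bounded n m (M : 'M[R]_(m, n)) :
  exists2 C : R, 0 < C & forall u, dot (M *m u) (M *m u) <= C * dot u u.
Proof.
(* The sum bounds the squared operator norm through absolute row sums; adding 1 keeps the constant
   positive even for [M = 0]. *)
exists (1 + \sum_i (\sum_j `|M i j|) ^+ 2).
  by rewrite ltr_wpDr // sumr_ge0 // => i _; rewrite sqr_ge0.
move=> u; rewrite mulrDl mul1r; apply: ler_wpDl; first exact: dot_ge0.
rewrite mulr_suml.
apply: ler_sum => i _; rewrite -expr2.
pose r := Num.sqrt (dot u u).
have r0 : 0 <= r by exact: sqrtr_ge0.
have -> : dot u u = r ^+ 2 by rewrite sqr_sqrtr // dot_ge0.
rewrite -exprMn -[leLHS]real_normK ?num_real //.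
rewrite ler_pXn2r ?nnegrE ?mulr_ge0 ?sumr_ge0 //.
rewrite mxE; apply: le_trans (ler_norm_sum _ _ _) _; rewrite mulr_suml.
apply: ler_sum => j _; rewrite normrM ler_wpM2l //.
by rewrite -sqrtr_sqr ler_wsqrtr // sqr_coord_le_dot.
Qed.

Definition qform n (M : 'M[R]_n) (u : 'cV[R]_n) : R := dot u (M *m u).

Lemma qform_bounded n (M : 'M[R]_n) :
  exists2 C : R, 0 < C & forall u, `|qform M u| <= C * dot u u.
Proof.
have [C C0 hC] := mulmx_bounded M.
exists ((1 + C) / 2); first by rewrite divr_gt0 ?addr_gt0.
move=> u; have := young_dot u (M *m u) ltr01; rewrite invr1 !mul1r => h.
have := hC u; rewrite /qform; lra.
Qed.

(** Nonnegativity at [s u + t v] suffices: [s = qform M v], [t = - b] gives the bound unless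
    [qform M v = 0], and then a nonzero [b] would let the form take the value -1. *)
Lemma qform_cauchy_schwarz n (M : 'M[R]_n) u v : M^T = M ->
  (forall w, 0 <= qform M w) -> dot u (M *m v) ^+ 2 <= qform M u * qform M v.
Proof.
move=> symM pos; set b := dot u _.
have hb : dot v (M *m u) = b by rewrite dot_mulmxr symM dotC.
have H s t : 0 <= s ^+ 2 * qform M u + 2 * s * t * b + t ^+ 2 * qform M v.
  have := pos (s *: u + t *: v).
  rewrite /qform mulmxDr -!scalemxAr !(dotDl, dotDr, dotZl, dotZr) hb -/b.
  by rewrite -!/(qform _ _); congr (_ <= _); ring.
have := pos v; rewrite le_eqVlt => /predU1P[v0|v0].
  rewrite -v0 mulr0; have [->|b0] := eqVneq b 0; first by rewrite expr0n.
  have := H 1 (- (qform M u + 1) / (2 * b)); rewrite -v0 mulr0 addr0 expr1n mul1r.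
  by rewrite (_ : _ + _ = -1); [lra | field].
have := H (qform M v) (- b).
rewrite (_ : _ + _ = qform M v * (qform M u * qform M v - b ^+ 2)); last by ring.
by rewrite pmulr_rge0 // subr_ge0.
Qed.

(** Cauchy-Schwarz for [M u] and [u] gives [|M u|^4 <= qform M (M u) * qform M u], and one factor
    [|M u|^2] cancels. Hence a semidefinite form vanishes only on the kernel of its matrix. *)
Lemma psd_mulmx_bound n (M : 'M[R]_n) : M^T = M ->
  (forall w, 0 <= qform M w) ->
  exists2 C : R, 0 < C & forall u, dot (M *m u) (M *m u) <= C * qform M u.
Proof.
move=> symM pos; have [C C0 hC] := qform_bounded M; exists C => // u.
have := qform_cauchy_schwarz (M *m u) u symM pos.
set z := dot _ _ => h.
have hz : 0 <= z by exact: dot_ge0.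
have hM : qform M (M *m u) <= C * z by apply: le_trans (ler_norm _) (hC _).
have [->|z0] := eqVneq z 0; first by rewrite mulr_ge0 // ltW.
have zp : 0 < z by rewrite lt_neqAle eq_sym z0.
rewrite -(ler_pM2l zp) -expr2; apply: le_trans h _.
by rewrite [leRHS]mulrA (mulrC z) ler_wpM2r.
Qed.

Lemma unitmx_of_ker0 n (M : 'M[R]_n) :
  (forall u : 'cV[R]_n, M *m u = 0 -> u = 0) -> M \in unitmx.
Proof.
move=> ker0; rewrite -unitmx_tr -row_free_unit -kermx_eq0.
apply/eqP/row_matrixP => i; rewrite row0; apply: trmx_inj; rewrite trmx0.
have : row i (kermx M^T) *m M^T = 0 by rewrite -row_mul mulmx_ker row0.
by move/(congr1 trmx); rewrite trmx_mul trmxK trmx0 => /ker0.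
Qed.

(** Replaces the smallest eigenvalue: [M] is invertible, so
    [|u|^2 <= D |M u|^2 <= D C * qform M u]. *)
Lemma pd_lower_bound n (M : 'M[R]_n) : M^T = M ->
  (forall u : 'cV[R]_n, u != 0 -> 0 < qform M u) ->
  exists2 a : R, 0 < a & forall u, a * dot u u <= qform M u.
Proof.
move=> symM pd.
have pos w : 0 <= qform M w.
  by have [->|/pd/ltW//] := eqVneq w 0; rewrite /qform dot0l.
have unitM : M \in unitmx.
  apply: unitmx_of_ker0 => u Mu; apply/eqP; apply: contraT => /pd.
  by rewrite /qform Mu dot0r ltxx.
have [C C0 hC] := psd_mulmx_bound symM pos.
have [D D0 hD] := mulmx_bounded (invmx M).
exists (D * C)^-1; first by rewrite invr_gt0 mulr_gt0.
move=> u; rewrite ler_pdivrMl ?mulr_gt0 // -mulrA.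
have := hD (M *m u); rewrite mulKmx // => /le_trans; apply.
by rewrite ler_pM2l.
Qed.

Lemma qform_add n (M M' : 'M[R]_n) u : qform (M + M') u = qform M u + qform M' u.
Proof. by rewrite /qform mulmxDl dotDr. Qed.

Lemma qform_scale n (M : 'M[R]_n) a u : qform (a *: M) u = a * qform M u.
Proof. by rewrite /qform -scalemxAl dotZr. Qed.

Lemma qform_gram n m (B : 'M[R]_(m, n)) u :
  qform (B^T *m B) u = dot (B *m u) (B *m u).
Proof. by rewrite /qform dot_mulmxl mulmxA. Qed.

(* The cross term [- eps (Qx).(QAx)] turns the semidefinite dissipation into a
   definite one: its derivative along x' = Ax contributes [- eps |QAx|^2]. *)
Lemma strict_lyapunov n (A P : 'M[R]_n) : P^T = P ->
  (forall x : 'cV[R]_n, x != 0 -> 0 < qform P x) ->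
  (forall x, dot (P *m x) (A *m x) <= 0) ->
  (forall x, dot (P *m x) (A *m x) = 0 ->
     dot (P *m (A *m x)) (A *m (A *m x)) = 0 -> x = 0) ->
  exists U : 'M[R]_n, U^T = U /\
  exists a b c : R, [/\ 0 < a, 0 < b, 0 < c,
    forall x, a * dot x x <= qform U x <= b * dot x x &
    forall x, 2 * dot (U *m x) (A *m x) <= - c * dot x x].
Proof.
move=> symP pdP diss obs.
(* Minus the symmetric part of [P *m A], so that [qform Q x] is the dissipation at [x]. *)
pose Q := (- 2^-1) *: (P *m A + A^T *m P).
have symQ : Q^T = Q by rewrite /Q linearZ /= linearD /= !trmx_mul trmxK symP addrC.
have formQ x : qform Q x = - dot (P *m x) (A *m x).
  rewrite /Q qform_scale qform_add {2}/qform -mulmxA dot_mulmxr trmxK dotC.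
  rewrite /qform -mulmxA dot_mulmxr symP; lra.
have psdQ x : 0 <= qform Q x by rewrite formQ oppr_ge0.
have [C1 C10 hC1] := psd_mulmx_bound symQ psdQ.
have kerQ x : Q *m x = 0 -> dot (P *m x) (A *m x) = 0.
  by move=> Qx; apply: oppr_inj; rewrite -formQ /qform Qx dot0r oppr0.
(* The form [|Q x|^2 + |Q A x|^2]. Its zeros have no dissipation at [x] nor at [A x], so [obs] makes
   it definite. *)
pose G := Q^T *m Q + (Q *m A)^T *m (Q *m A).
have [a3 a30 ha3] : exists2 a : R, 0 < a & forall u, a * dot u u <= qform G u.
  apply: pd_lower_bound; first by rewrite /G linearD /= !trmx_mul !trmxK.
  move=> x x0; rewrite /G qform_add !qform_gram lt_neqAle addr_ge0 ?dot_ge0 // andbT.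
  apply: contra x0; rewrite eq_sym paddr_eq0 ?dot_ge0 //.
  move=> /andP[/eqP/dot_eq0 h1 /eqP/dot_eq0 h2].
  by apply/eqP/obs; apply: kerQ => //; rewrite mulmxA.
have [C2 C20 hC2] := mulmx_bounded (Q *m A *m A).
pose T := Q^T *m (Q *m A).
have formT x : qform T x = dot (Q *m x) (Q *m A *m x).
  by rewrite /qform /T -[_ *m x]mulmxA dot_mulmxr trmxK.
have [C4 C40 hC4] := qform_bounded T.
have [a a0 ha] := pd_lower_bound symP pdP.
have [b b0 hb] := qform_bounded P.
(* With this [s], Young's inequality charges the cross term [(Q x).(Q A A x)] at most
   [a3 / 2 * |x|^2], half of what [G] provides, plus a multiple of [|Q x|^2] controlled by
   [K * qform Q x]. *)
pose s := a3 / C2; have s0 : 0 < s by rewrite divr_gt0.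
pose K := C1 * (1 + s^-1).
have K0 : 0 < K by rewrite mulr_gt0 ?addr_gt0 ?invr_gt0.
(* The first bound lets the dissipation absorb [e * K * qform Q x]; the second keeps [qform U x]
   above [a / 2 * |x|^2]. *)
pose e := Num.min (K^-1) (a / (2 * C4)).
have e0 : 0 < e by rewrite lt_min invr_gt0 K0 divr_gt0 ?mulr_gt0.
have eK : e * K <= 1 by rewrite -ler_pdivlMr // div1r ge_min lexx.
have eC4 : e * C4 <= a / 2.
  by rewrite -ler_pdivlMr // -mulrA -invfM ge_min lexx orbT.
pose U := P + (- (e / 2)) *: (T + T^T).
have formTT x : qform T^T x = qform T x by rewrite /qform dot_mulmxr trmxK dotC.
have formU x : qform U x = qform P x - e * qform T x.
  by rewrite /U qform_add qform_scale qform_add formTT; field.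
exists U; split.
  by rewrite /U linearD /= linearZ /= linearD /= trmxK symP (addrC T).
exists (a / 2), (b + a / 2), (e * a3 / 2); split.
- by rewrite divr_gt0.
- by rewrite addr_gt0 ?divr_gt0.
- by rewrite divr_gt0 ?mulr_gt0.
- move=> x; rewrite formU.
  have := ha x; have := hb x; have := hC4 x; have := dot_ge0 x.
  move=> d0 h1 h2 h3.
  have : `|e * qform T x| <= a / 2 * dot x x.
    rewrite normrM (gtr0_norm e0); apply: (@le_trans _ _ (e * (C4 * dot x x))).
      by rewrite ler_pM2l.
    by rewrite mulrA ler_wpM2r.
  rewrite ler_norml => /andP[h4 h5]; have := ler_norm (qform P x).
  by move=> h6; apply/andP; split; lra.
move=> x.
have -> : 2 * dot (U *m x) (A *m x) = - 2 * qform Q x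
   - e * (dot (Q *m A *m x) (Q *m A *m x) + dot (Q *m x) (Q *m A *m A *m x)).
  rewrite formQ /U mulmxDl -scalemxAl dotDl dotZl mulmxDl dotDl.
  have -> : dot (T *m x) (A *m x) = dot (Q *m A *m x) (Q *m A *m x).
    by rewrite /T -mulmxA dot_mulmxl trmxK mulmxA.
  have -> : dot (T^T *m x) (A *m x) = dot (Q *m x) (Q *m A *m A *m x).
    by rewrite dot_mulmxl trmxK /T -!mulmxA dot_mulmxr trmxK.
  by field.
have h3 := ha3 x; rewrite /G qform_add !qform_gram in h3.
have h1 := hC1 x; have h2 := hC2 x; have d0 := dot_ge0 x; have q0 := psdQ x.
have hy := young_dot (Q *m x) (Q *m A *m A *m x) s0.
have h4 : s * dot (Q *m A *m A *m x) (Q *m A *m A *m x) <= a3 * dot x x.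
  by rewrite /s -mulrA ler_pM2l // ler_pdivrMl.
have h5 : (1 + s^-1) * dot (Q *m x) (Q *m x) <= K * qform Q x.
  by rewrite /K [C1 * _]mulrC -mulrA ler_pM2l ?addr_gt0 ?invr_gt0.
have h6 : e * K * qform Q x <= qform Q x by rewrite ler_piMl.
have h7 := ler_norm (- dot (Q *m x) (Q *m A *m A *m x)); rewrite normrN in h7.
have z0 : 0 <= s^-1 * dot (Q *m x) (Q *m x).
  by rewrite mulr_ge0 ?dot_ge0 // invr_ge0 ltW.
have : a3 / 2 * dot x x - K * qform Q x <=
    dot (Q *m A *m x) (Q *m A *m x) + dot (Q *m x) (Q *m A *m A *m x).
  by rewrite mulrDl mul1r in h5; lra.
rewrite -(ler_pM2l e0) mulrBr => h8; lra.
Qed.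
End Dot.

(** * Stability of affine systems *)

Section Linear_ODE.
Local Open Scope classical_set_scope.
Variable R : realType.

(** The norm of a column is its largest absolute entry. This bound and [dot_le_sqr_norm] compare it
    with the Euclidean [dot], at the price of a factor [n]. *)
Lemma sqr_norm_le_dot n (u : 'cV[R]_n) : `|u| ^+ 2 <= dot u u.
Proof.
have : `|u| <= Num.sqrt (dot u u).
  rewrite [leLHS]/Num.Def.normr/= mx_normrE (bigmax_le _ (sqrtr_ge0 _))//=.
  move=> -[i j] _ /=.
  by rewrite ord1 -sqrtr_sqr ler_wsqrtr // sqr_coord_le_dot.
rewrite -(@ler_pXn2r _ 2) ?nnegrE ?sqrtr_ge0 //.
by rewrite sqr_sqrtr // dot_ge0.
Qed.

Lemma dot_le_sqr_norm n (u : 'cV[R]_n) : dot u u <= n%:R * `|u| ^+ 2.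
Proof.
rewrite /dot -[n in n%:R]card_ord -sum1_card natr_sum mulr_suml.
apply: ler_sum => i _; rewrite mul1r -expr2 -real_normK ?num_real //.
rewrite ler_pXn2r ?nnegrE // [leRHS]/Num.Def.normr/= mx_normrE.
exact: (le_bigmax _ _ (i, 0)).
Qed.

Lemma is_derive_coord n (x : R -> 'cV[R]_n) (t : R) dx i :
  is_derive t 1 x dx -> is_derive t 1 (fun s => x s i 0) (dx i 0).
Proof.
move=> [dfx <-]; have /derivable_mxP h := dfx.
by rewrite derive_mx // mxE; apply/derivableP.
Qed.

(** The form is expanded into products of coordinates, where the product rule applies; symmetry of
    [U] merges the two resulting sums. *)
Lemma is_derive_qform n (U : 'M[R]_n) (x : R -> 'cV[R]_n) (t : R) dx :
  U^T = U -> is_derive t 1 x dx ->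
  is_derive t 1 (fun s : R => qform U (x s)) (2 * dot (U *m x t) dx).
Proof.
move=> symU hx.
have -> : (fun s : R => qform U (x s)) =
    \sum_i \sum_j (U i j *: ((fun s : R => x s i 0) * (fun s : R => x s j 0))).
  apply/funext => s; rewrite fct_sumE; apply: eq_bigr => i _.
  rewrite fct_sumE mxE mulr_sumr; apply: eq_bigr => j _; exact: mulrCA.
have -> : 2 * dot (U *m x t) dx =
    \sum_i \sum_j U i j *: (x t i 0 *: dx j 0 + x t j 0 *: dx i 0).
  transitivity (dot (x t) (U *m dx) + dot dx (U *m x t)).
    by rewrite dot_mulmxr symU (dotC dx); ring.
  rewrite -big_split /=; apply: eq_bigr => i _.
  rewrite !mxE !mulr_sumr -big_split /=; apply: eq_bigr => j _.
  by rewrite /GRing.scale /=; ring.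
apply: is_derive_sum => i; apply: is_derive_sum => j.
by apply/is_deriveZ/is_deriveM; exact: is_derive_coord.
Qed.

Lemma continuous_qform n (U : 'M[R]_n) : continuous (qform U).
Proof.
have -> : qform U = fun u => \sum_i u i 0 * \sum_j U i j * u j 0.
  by apply/funext => u; apply: eq_bigr => i _; rewrite mxE.
apply: continuous_big => [|i _ u]; first exact: add_continuous.
apply: (@cvgM _ _ (nbhs u)); first exact: coord_continuous.
apply: continuous_big => [|j _ v]; first exact: add_continuous.
by apply: (@cvgM _ _ (nbhs v)); [exact: cvg_cst | exact: coord_continuous].
Qed.

(** For [y = x - xe] the rate of [qform U y] is at most [- c |y|^2 <= - (c / b) * qform U y], so
    [expR (c / b * t) * qform U y] does not increase. The factor [n] comes from the max norm. *)
Lemma solution_exp_decay n (f : 'cV[R]_n -> 'cV[R]_n) (A U : 'M[R]_n) xe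
    (a b c : R) :
  (forall x, f x = A *m (x - xe)) -> U^T = U -> 0 < a -> 0 < b -> 0 < c ->
  (forall x, a * dot x x <= qform U x <= b * dot x x) ->
  (forall x, 2 * dot (U *m x) (A *m x) <= - c * dot x x) ->
  forall x, solution f x -> forall t, 0 <= t ->
  `|x t - xe| ^+ 2 <= (n%:R * b / a) * `|x 0 - xe| ^+ 2 * expR (- (c / b * t)).
Proof.
move=> fE symU a0 b0 c0 hab hc x [cx dx] t t0.
pose k := c / b; have k0 : 0 < k by rewrite divr_gt0.
pose y s := x s - xe.
pose u s := qform U (y s).
pose h s := expR (k * s) * u s.
have dy (s : R) : 0 < s -> is_derive s 1 y (A *m y s).
  move=> s0; have hx := dx s s0.
  have := is_deriveB hx (is_derive_cst xe s 1); rewrite subr0 fE.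
  by [].
have dh (s : R) : 0 < s -> is_derive s 1 h
    (expR (k * s) * (2 * dot (U *m y s) (A *m y s)) + u s * (k * expR (k * s))).
  move=> s0; have hu := is_derive_qform symU (dy s s0).
  have he : is_derive s 1 (fun s : R => expR (k * s)) (k * expR (k * s)).
    have hk := is_deriveZ k (is_derive_id s (1 : R)).
    have := is_derive1_comp (is_derive_expR (k * s)) hk.
    by rewrite mulrC /GRing.scale /= mulr1.
  exact: (is_deriveM he hu).
have cy : {within `[0, +oo[, continuous y}.
  by move=> s; apply: cvgB; [exact: cx | exact: cvg_cst].
have ch : {within `[0, t], continuous h}.
  move=> s; apply: cvgM.
    apply: (@continuous_subspaceT _ _ `[0, t] (fun s => expR (k * s))) => {}s.
    by apply: continuous_comp; [exact: mulrl_continuous | exact: continuous_expR].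
  have cyt : {within `[0, t], continuous y}.
    apply: continuous_subspaceW cy; apply: subset_itv; by rewrite bnd_simp.
  exact: (cvg_comp _ _ (cyt s) (@continuous_qform _ U (y s))).
(* The differential equation holds only at positive times, so monotonicity uses the derivative on
   the open interval and continuity up to 0. *)
have hle : h t <= h 0.
  apply: (@ler0_derive1_le_cc _ h 0 t); rewrite ?in_itv /= ?lexx ?t0 //.
  - by move=> s; rewrite in_itv /= => /andP[s0 _]; have [] := dh s s0.
  move=> s; rewrite in_itv /= => /andP[s0 _].
  rewrite derive1E; have [_ ->] := dh s s0.
  have := hc (y s); have /andP[_] := hab (y s); rewrite -/(u s) => h1 h2.
  have -> : forall e p : R, e * p + u s * (k * e) = e * (p + k * u s) by move=> *; ring.
  rewrite pmulr_rle0 ?expR_gt0 //.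
  have : k * u s <= c * dot (y s) (y s).
    by rewrite /k mulrAC ler_pdivrMr // -mulrA (mulrC _ b) ler_pM2l.
  by move: h2; rewrite mulNr; lra.
move: hle; rewrite /h mulr0 expR0 mul1r mulrC -ler_pdivlMr ?expR_gt0 // -expRN => hle.
have /andP[h1 _] := hab (y t); have /andP[_ h2] := hab (y 0).
rewrite -(ler_pM2l a0).
apply: le_trans (_ : a * dot (y t) (y t) <= _).
  by rewrite ler_pM2l // sqr_norm_le_dot.
apply: le_trans h1 _; apply: le_trans hle _.
rewrite [leRHS](_ : _ = b * (n%:R * `|y 0| ^+ 2) * expR (- (k * t))); last first.
  by rewrite /y /k; field; rewrite !gt_eqF.
rewrite ler_pM2r ?expR_gt0 //; apply: le_trans h2 _.
by rewrite ler_pM2l // dot_le_sqr_norm.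
Qed.

Lemma exp_decay_gas (X : normedModType R) (f : X -> X) xe (K k : R) :
  0 <= K -> 0 < k ->
  (forall x, solution f x -> forall t, 0 <= t ->
     `|x t - xe| ^+ 2 <= K * `|x 0 - xe| ^+ 2 * expR (- (k * t))) ->
  globally_asymptotically_stable f xe.
Proof.
move=> K0 k0 H; split.
(* [K + 1] is positive even when [K = 0], and [K <= (K + 1)^2]. *)
- move=> eps e0; exists (eps / (K + 1)); first by rewrite divr_gt0 ?ltr_wpDl.
  move=> x sx; rewrite ltr_pdivlMr ?ltr_wpDl // => xd t t0.
  rewrite -(@ltr_pXn2r _ 2) ?nnegrE ?(ltW e0) //.
  apply: le_lt_trans (H _ sx t t0) _.
  apply: (@le_lt_trans _ _ (K * `|x 0 - xe| ^+ 2)).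
    rewrite ler_piMr ?mulr_ge0 ?sqr_ge0 // -expR0 ler_expR oppr_le0.
    by rewrite mulr_ge0 // ltW.
  apply: (@le_lt_trans _ _ ((`|x 0 - xe| * (K + 1)) ^+ 2)).
    rewrite exprMn mulrC ler_wpM2l ?sqr_ge0 //; nra.
  by rewrite ltr_pXn2r ?nnegrE ?(ltW e0) // mulr_ge0 // addr_ge0.
move=> x sx; apply/cvgrPdist_lt => e e0.
pose C := K * `|x 0 - xe| ^+ 2; have C0 : 0 <= C by rewrite mulr_ge0 ?sqr_ge0.
near=> t; rewrite distrC -(@ltr_pXn2r _ 2) ?nnegrE ?(ltW e0) //.
have t0 : 0 <= t by near: t; exact: nbhs_pinfty_ge.
apply: le_lt_trans (H _ sx t t0) _; rewrite -/C expRN.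
rewrite ltr_pdivrMr ?expR_gt0 // -ltr_pdivrMl ?exprn_gt0 //.
(* The bound [1 + k t <= expR (k * t)] gives an explicit time after which the distance is below
   [e]. *)
apply: lt_le_trans (expR_ge1Dx _).
suff : (e ^+ 2)^-1 * C / k < t by rewrite ltr_pdivrMr // mulrC; lra.
by near: t; apply: nbhs_pinfty_gt; exact: num_real.
Unshelve. all: by end_near. Qed.

(* LaSalle's principle with one-step observability. *)
Theorem affine_lyapunov_gas n (f : 'cV[R]_n -> 'cV[R]_n) (A P : 'M[R]_n) c :
  (forall x, f x = A *m x + c) -> P^T = P ->
  (forall x : 'cV[R]_n, x != 0 -> 0 < qform P x) ->
  (forall x, dot (P *m x) (A *m x) <= 0) ->
  (forall x, dot (P *m x) (A *m x) = 0 ->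
     dot (P *m (A *m x)) (A *m (A *m x)) = 0 -> x = 0) ->
  exists xe, unique (equilibrium f) xe /\ globally_asymptotically_stable f xe.
Proof.
move=> fE symP pdP diss obs.
(* If [A x = 0], the dissipation vanishes at [x] and at [A x], so observability makes [A] injective;
   this yields the unique equilibrium. *)
have kerA (x : 'cV[R]_n) : A *m x = 0 -> x = 0.
  by move=> Ax; apply: obs; rewrite Ax ?mulmx0 dot0r.
have unitA := unitmx_of_ker0 kerA.
pose xe := - (invmx A *m c).
have fxe : f xe = 0 by rewrite fE mulmxN mulKVmx // addNr.
have fE' x : f x = A *m (x - xe).
  by rewrite mulmxBr -[LHS]subr0 -fxe !fE opprD addrACA subrr addr0.
exists xe; split.
  split=> // x; rewrite /equilibrium fE' => /kerA /eqP.
  by rewrite subr_eq0 => /eqP.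
have [U [symU [a [b [d [a0 b0 d0 hab hd]]]]]] := strict_lyapunov symP pdP diss obs.
apply: (@exp_decay_gas _ _ _ (n%:R * b / a) (d / b)).
- by rewrite divr_ge0 ?mulr_ge0 // ltW.
- by rewrite divr_gt0.
exact: solution_exp_decay hab hd.
Qed.

End Linear_ODE.

(** * Laplacians and linear maps *)

Section Laplacian.
Variables (R : realType) (n : nat) (e : rel 'I_n) (w : 'I_n -> 'I_n -> R).
Hypothesis gw : weighted_graph e w.

(** Weights extended by zero off the edges, so that sums may run over all pairs. *)
Let a i j := if e i j then w i j else 0.

Lemma adj_ge0 i j : 0 <= a i j.
Proof. by rewrite /a; case: ifP => // eij; case: gw => _ _ /(_ _ _ eij)[/ltW]. Qed.

Lemma adj_sym i j : a i j = a j i.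
Proof.
rewrite /a; case: gw => esym _ hw; rewrite (esym i j).
by case: ifP => // eji; have [_ ->] := hw _ _ eji.
Qed.

Lemma laplacian_mulE (u : 'cV[R]_n) i :
  (laplacian e w *m u) i 0 = \sum_j a i j * (u i 0 - u j 0).
Proof.
rewrite mxE; have [_ eirr _] := gw.
transitivity ((\sum_j a i j) * u i 0 - \sum_j a i j * u j 0); last first.
  by rewrite mulr_suml -sumrB; apply: eq_bigr => j _; rewrite mulrBr.
rewrite (bigD1 i) //= mxE eqxx big_mkcond /=; congr (_ + _).
rewrite [X in - X](bigD1 i) //= {1}/a eirr mul0r add0r -sumrN.
apply: eq_bigr => j ji; rewrite mxE eq_sym (negbTE ji) /a.
by case: ifP => _; rewrite ?mulNr // mul0r oppr0.
Qed.

(** Exchanging [i] and [j] gives a second expression for the same sum, and the average of the two is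
    symmetric in the differences. *)
Lemma laplacian_dotE (u v : 'cV[R]_n) : dot u (laplacian e w *m v) =
  2^-1 * \sum_i \sum_j a i j * ((u i 0 - u j 0) * (v i 0 - v j 0)).
Proof.
have -> : dot u (laplacian e w *m v) =
    \sum_i \sum_j u i 0 * (a i j * (v i 0 - v j 0)).
  by apply: eq_bigr => i _; rewrite laplacian_mulE mulr_sumr.
set s := LHS; have hs : s = \sum_i \sum_j u j 0 * (a i j * (v j 0 - v i 0)).
  rewrite /s exchange_big /=; apply: eq_bigr => i _; apply: eq_bigr => j _.
  by rewrite adj_sym.
have -> : s = 2^-1 * (s + s) by lra.
rewrite {2}hs /s -big_split /=; congr (_ * _); apply: eq_bigr => i _.
rewrite -big_split /=; apply: eq_bigr => j _; ring.
Qed.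

Lemma laplacian_sym : (laplacian e w)^T = laplacian e w.
Proof.
have [esym _ hw] := gw; apply/matrixP => i j; rewrite !mxE eq_sym (esym j i).
by case: eqVneq => [->//|_]; case: ifP => // /hw[_ ->].
Qed.

Lemma laplacian_ones : laplacian e w *m ones n = 0.
Proof.
apply/colP => i; rewrite laplacian_mulE [RHS]mxE big1 // => j _.
by rewrite !mxE subrr mulr0.
Qed.

Lemma laplacian_qform_ge0 u : 0 <= qform (laplacian e w) u.
Proof.
rewrite /qform laplacian_dotE mulr_ge0 ?invr_ge0 // sumr_ge0 // => i _.
by rewrite sumr_ge0 // => j _; rewrite mulr_ge0 ?adj_ge0 // -expr2 sqr_ge0.
Qed.

(** A vanishing sum of nonnegative edge terms forces equal values across each edge, and hence along
    every path. *)
Lemma laplacian_qform0_const u : connected_graph e ->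
  qform (laplacian e w) u = 0 -> forall i j, u i 0 = u j 0.
Proof.
move=> econn; rewrite /qform laplacian_dotE => /eqP.
rewrite mulf_eq0 invr_eq0 pnatr_eq0 /= => /eqP s0.
have h i j : 0 <= a i j * ((u i 0 - u j 0) * (u i 0 - u j 0)).
  by rewrite mulr_ge0 ?adj_ge0 // -expr2 sqr_ge0.
have edge i j : e i j -> u i 0 = u j 0.
  move=> eij; have /psumr_eq0P := s0 => /(_ (fun _ _ => sumr_ge0 _ (fun _ _ => h _ _))).
  move=> /(_ i isT) /psumr_eq0P => /(_ (fun _ _ => h _ _)) /(_ j isT) /eqP.
  have [_ _ /(_ _ _ eij) [w0 _]] := gw.
  by rewrite /a eij !mulf_eq0 gt_eqF //= orbb subr_eq0 => /eqP.
move=> i j; have /connectP[p] := econn i j.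
by elim: p i => [|k p IH] i /= => [_ -> // | /andP[/edge -> hp] /IH]; apply.
Qed.

End Laplacian.

(** * Reduced coordinates orthogonal to the all-ones vector *)

Section Extend.
Variables (R : realType) (n : nat) (S : 'M[R]_(n.+1, n)).
Hypothesis oS : orthogonal_matrix (extend_by_ones S).

Let c : 'cV[R]_n.+1 := (Num.sqrt n.+1%:R)^-1 *: ones n.+1.

Let QTQ : block_mx (c^T *m c) (c^T *m S) (S^T *m c) (S^T *m S) =
          block_mx 1%:M 0 0 1%:M.
Proof.
by rewrite -(@scalar_mx_block _ 1 n) -mul_col_row -tr_row_mx; exact: oS.
Qed.

Lemma orthogonal_extend_tr_mul : S^T *m S = 1%:M.
Proof. by have /eq_block_mx[] := QTQ. Qed.

Lemma orthogonal_extend_tr_ones : S^T *m ones n.+1 = 0.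
Proof.
have /eq_block_mx[_ _ + _] := QTQ; rewrite /c -scalemxAr => /eqP.
rewrite scaler_eq0 invr_eq0 => /orP[|/eqP//].
by rewrite gt_eqF // sqrtr_gt0 ltr0n.
Qed.

(** The rows of the extended matrix are also orthonormal, so [S *m S^T] is the identity minus the
    projection onto [ones], which [L] annihilates. *)
Lemma orthogonal_extend_mul_tr (L : 'M[R]_n.+1) : L *m ones n.+1 = 0 ->
  L *m S *m S^T = L.
Proof.
move=> L1; have /mulmx1C : orthogonal_matrix (extend_by_ones S) := oS.
have -> : extend_by_ones S *m (extend_by_ones S)^T = c *m c^T + S *m S^T.
  by rewrite -mul_row_col -tr_row_mx.
move=> /(congr1 (mulmx L)).
by rewrite mulmx1 mulmxDr mulmxA -scalemxAr L1 scaler0 mul0mx add0r mulmxA.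
Qed.

(** Since [v = S^T S v], a constant [S v] is sent to a multiple of [S^T *m ones = 0]. With
    connectedness this makes the reduced stiffness definite. *)
Lemma orthogonal_extend_const (v : 'cV[R]_n) :
  (forall i j, (S *m v) i 0 = (S *m v) j 0) -> v = 0.
Proof.
move=> h; rewrite -[v]mul1mx -orthogonal_extend_tr_mul -mulmxA.
have -> : S *m v = (S *m v) 0 0 *: ones n.+1.
  by apply/colP => i; rewrite (h i 0) [RHS]mxE [ones _ _ _]mxE mulr1.
by rewrite -scalemxAr orthogonal_extend_tr_ones scaler0.
Qed.

End Extend.

(** * Linear and bilinear maps represented by a matrix *)

Section Linear_maps.
Variables (R : realType) (n : nat).

(** The matrix stays existential: linearity of the closed loop follows from closure properties, and
    its large block matrix is never written out. *)
Definition is_mulmx m (g : 'cV[R]_n -> 'cV[R]_m) :=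
  exists A, forall x, g x = A *m x.

Lemma is_mulmx_id : is_mulmx id.
Proof. by exists 1%:M => x; rewrite mul1mx. Qed.

Lemma is_mulmxM m p (M : 'M[R]_(p, m)) g :
  is_mulmx g -> is_mulmx (fun x => M *m g x).
Proof. by move=> [A hA]; exists (M *m A) => x; rewrite hA mulmxA. Qed.

Lemma is_mulmxD m (g h : 'cV[R]_n -> 'cV[R]_m) :
  is_mulmx g -> is_mulmx h -> is_mulmx (fun x => g x + h x).
Proof. by move=> [A hA] [B hB]; exists (A + B) => x; rewrite hA hB mulmxDl. Qed.

Lemma is_mulmxZ m k (g : 'cV[R]_n -> 'cV[R]_m) :
  is_mulmx g -> is_mulmx (fun x => k *: g x).
Proof. by move=> [A hA]; exists (k *: A) => x; rewrite hA scalemxAl. Qed.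

Lemma is_mulmxN m (g : 'cV[R]_n -> 'cV[R]_m) :
  is_mulmx g -> is_mulmx (fun x => - g x).
Proof. by move=> [A hA]; exists (- A) => x; rewrite hA mulNmx. Qed.

Lemma is_mulmx_sum m (I : finType) (g : I -> 'cV[R]_n -> 'cV[R]_m) :
  (forall i, is_mulmx (g i)) -> is_mulmx (fun x => \sum_i g i x).
Proof.
move=> hg; exists (\sum_i sval (cid (hg i))) => x.
by rewrite mulmx_suml; apply: eq_bigr => i _; exact: (svalP (cid (hg i))).
Qed.

Lemma is_mulmx_scale_coord m p k i (v : 'cV[R]_p) (g : 'cV[R]_n -> 'cV[R]_m) :
  is_mulmx g -> is_mulmx (fun x => (k * g x i 0) *: v).
Proof.
move=> [A hA]; exists (k *: v *m row i A) => x.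
rewrite -mulmxA -row_mul -hA; apply/colP => j.
by rewrite !mxE big_ord1 !mxE mulrAC.
Qed.

Lemma is_mulmx_usub m p (g : 'cV[R]_n -> 'cV[R]_(m + p)) :
  is_mulmx g -> is_mulmx (fun x => usubmx (g x)).
Proof.
by move=> [A hA]; exists (usubmx A) => x; rewrite hA mul_usub_mx.
Qed.

Lemma is_mulmx_dsub m p (g : 'cV[R]_n -> 'cV[R]_(m + p)) :
  is_mulmx g -> is_mulmx (fun x => dsubmx (g x)).
Proof.
by move=> [A hA]; exists (dsubmx A) => x; rewrite hA mul_dsub_mx.
Qed.

Lemma is_mulmx_col m p (g : 'cV[R]_n -> 'cV[R]_m) (h : 'cV[R]_n -> 'cV[R]_p) :
  is_mulmx g -> is_mulmx h -> is_mulmx (fun x => col_mx (g x) (h x)).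
Proof. by move=> [A hA] [B hB]; exists (col_mx A B) => x; rewrite hA hB mul_col_mx. Qed.

Lemma is_mulmx_mxcol k (p : 'I_k -> nat) (g : forall i, 'cV[R]_n -> 'cV[R]_(p i)) :
  (forall i, is_mulmx (g i)) -> is_mulmx (fun x => \mxcol_i g i x).
Proof.
move=> hg; exists (\mxcol_i sval (cid (hg i))) => x.
by rewrite mxcol_mul; apply: eq_mxcol => i; rewrite (svalP (cid (hg i))).
Qed.

Lemma is_mulmx_submxcol k (p : 'I_k -> nat) (g : 'cV[R]_n -> 'cV[R]_(\sum_i p i)) i :
  is_mulmx g -> is_mulmx (fun x => submxcol (g x) i).
Proof.
move=> [A hA]; exists (submxcol A i) => x.
by rewrite hA submxcol_mul.
Qed.

Definition is_bilinear_mx (B : 'cV[R]_n -> 'cV[R]_n -> R) :=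
  exists P : 'M[R]_n, forall x y, B x y = dot (P *m x) y.

Lemma is_bilinear_mx_dot m (g h : 'cV[R]_n -> 'cV[R]_m) :
  is_mulmx g -> is_mulmx h -> is_bilinear_mx (fun x y => dot (g x) (h y)).
Proof.
move=> [A hA] [B hB]; exists (B^T *m A) => x y.
by rewrite hA hB -mulmxA dot_mulmxr.
Qed.

Lemma is_bilinear_mxD B C : is_bilinear_mx B -> is_bilinear_mx C ->
  is_bilinear_mx (fun x y => B x y + C x y).
Proof. by move=> [P hP] [Q hQ]; exists (P + Q) => x y; rewrite hP hQ mulmxDl dotDl. Qed.

Lemma is_bilinear_mxZ k B : is_bilinear_mx B ->
  is_bilinear_mx (fun x y => k * B x y).
Proof. by move=> [P hP]; exists (k *: P) => x y; rewrite hP -scalemxAl dotZl. Qed.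

Lemma is_bilinear_mx_sum (I : finType) (B : I -> 'cV[R]_n -> 'cV[R]_n -> R) :
  (forall i, is_bilinear_mx (B i)) -> is_bilinear_mx (fun x y => \sum_i B i x y).
Proof.
move=> hB; exists (\sum_i sval (cid (hB i))) => x y.
rewrite mulmx_suml (big_morph (fun z => dot z y) (fun u v => dotDl u v y) (dot0l y)).
by apply: eq_bigr => i _; exact: (svalP (cid (hB i))).
Qed.

Lemma bilinear_mx_sym (P : 'M[R]_n) :
  (forall x y, dot (P *m x) y = dot (P *m y) x) -> P^T = P.
Proof.
move=> h; apply/matrixP => i j.
have := h (unit_vec i) (unit_vec j).
by rewrite !dot_unit_vec /unit_vec -!colE !mxE.
Qed.

End Linear_maps.

(** * The closed loop *)

Section Diag.
Variable R : realType.

Lemma diag_of_mulE n (a : 'I_n -> R) (u : 'cV[R]_n) i :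
  (diag_of a *m u) i 0 = a i * u i 0.
Proof. by rewrite /diag_of mul_diag_mx !mxE. Qed.

Lemma dot_diag n (a : 'I_n -> R) (u v : 'cV[R]_n) :
  dot u (diag_of a *m v) = \sum_i a i * (u i 0 * v i 0).
Proof. by apply: eq_bigr => i _; rewrite diag_of_mulE mulrCA. Qed.

Lemma dot_diag_sym n (a : 'I_n -> R) (u v : 'cV[R]_n) :
  dot (diag_of a *m u) v = dot (diag_of a *m v) u.
Proof. by rewrite dotC !(dotC (_ *m _)) !dot_diag; under eq_bigr do rewrite (mulrC (v _ 0)). Qed.

Lemma dot_diag_diagV n (a : 'I_n -> R) (u v : 'cV[R]_n) :
  (forall i, 0 < a i) ->
  dot (diag_of a *m u) (diag_of (fun i => (a i)^-1) *m v) = dot u v.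
Proof.
move=> a0; apply: eq_bigr => i _; rewrite !diag_of_mulE.
by rewrite mulrACA mulfV ?gt_eqF ?a0 // mul1r.
Qed.

Lemma qform_diag_ge0 n (a : 'I_n -> R) (u : 'cV[R]_n) :
  (forall i, 0 < a i) -> 0 <= qform (diag_of a) u.
Proof.
move=> a0; rewrite /qform dot_diag sumr_ge0 // => i _.
by rewrite mulr_ge0 ?(ltW (a0 i)) // -expr2 sqr_ge0.
Qed.

Lemma qform_diag_ge n (a : 'I_n -> R) (u : 'cV[R]_n) i :
  (forall i, 0 < a i) -> a i * u i 0 ^+ 2 <= qform (diag_of a) u.
Proof.
move=> a0; rewrite /qform dot_diag (bigD1 i) //= expr2 lerDl sumr_ge0 // => j _.
by rewrite mulr_ge0 ?(ltW (a0 j)) // -expr2 sqr_ge0.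
Qed.

Lemma qform_diag_eq0 n (a : 'I_n -> R) (u : 'cV[R]_n) :
  (forall i, 0 < a i) -> qform (diag_of a) u = 0 -> u = 0.
Proof.
move=> a0 u0; apply/colP => i; rewrite mxE; apply/eqP.
have := qform_diag_ge u i a0; rewrite u0 pmulr_rle0 // => h.
by rewrite -sqrf_eq0 eq_le h sqr_ge0.
Qed.

Lemma col_sum_unit_vec n (a : 'I_n -> R) :
  \sum_i a i *: unit_vec i = \col_i a i.
Proof.
apply/colP => k; rewrite summxE (bigD1 k) //= !mxE !eqxx mulr1 big1 ?addr0 // => i ik.
by rewrite !mxE eq_sym (negbTE ik) mulr0.
Qed.

Lemma mul_unit_vec_tr n m (v : 'cV[R]_n) (u : 'cV[R]_m) i :
  v *m (unit_vec i)^T *m u = u i 0 *: v.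
Proof.
apply/colP => k; rewrite -mulmxA [LHS]mxE big_ord1 [RHS]mxE mulrC.
by rewrite -dot_mxE dotC dot_unit_vec.
Qed.

Lemma mul_unit_vec_l n m (a v : 'cV[R]_m) (i : 'I_n) :
  unit_vec i *m a^T *m v = dot a v *: unit_vec i.
Proof.
by apply/colP => k; rewrite -mulmxA [LHS]mxE big_ord1 [RHS]mxE mulrC dot_mxE.
Qed.

End Diag.

(** * Components of the stacked state *)

Section State.
Variables (R : realType) (N : nat) (d : 'I_N.+1 -> nat).
Implicit Types (x y : 'cV[R]_(state_dim d)).

Lemma delta_of_pack de om V et ph i :
  delta_of (pack de om V et ph : 'cV[R]_(state_dim d)) i = de i.
Proof. by rewrite /delta_of /pack col_mxKu mxcolK. Qed.

Lemma omega_of_pack de om V et ph i :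
  omega_of (pack de om V et ph : 'cV[R]_(state_dim d)) i = om i.
Proof. by rewrite /omega_of /pack col_mxKd col_mxKu mxcolK. Qed.

Lemma V_of_pack de om V et ph :
  V_of (pack de om V et ph : 'cV[R]_(state_dim d)) = V.
Proof. by rewrite /V_of /pack !col_mxKd col_mxKu. Qed.

Lemma eta_of_pack de om V et ph :
  eta_of (pack de om V et ph : 'cV[R]_(state_dim d)) = et.
Proof. by rewrite /eta_of /pack !col_mxKd col_mxKu. Qed.

Lemma phi_of_pack de om V et ph :
  phi_of (pack de om V et ph : 'cV[R]_(state_dim d)) = ph.
Proof. by rewrite /phi_of /pack !col_mxKd. Qed.

Definition pack_ofE :=
  (delta_of_pack, omega_of_pack, V_of_pack, eta_of_pack, phi_of_pack).

Lemma state_eq0 x : (forall i, delta_of x i = 0) -> (forall i, omega_of x i = 0) ->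
  V_of x = 0 -> eta_of x = 0 -> phi_of x = 0 -> x = 0.
Proof.
rewrite /delta_of /omega_of /V_of /eta_of /phi_of => h1 h2 h3 h4 h5.
rewrite -[x]vsubmxK -[dsubmx x]vsubmxK -[dsubmx (dsubmx x)]vsubmxK.
rewrite -[dsubmx (dsubmx (dsubmx x))]vsubmxK h3 h4 h5.
rewrite -[usubmx x]submxcolK (eq_mxcol h1) mxcol0.
by rewrite -[usubmx (dsubmx x)]submxcolK (eq_mxcol h2) mxcol0 !col_mx0.
Qed.

Lemma packD de om V et ph de' om' V' et' ph' :
  pack de om V et ph + pack de' om' V' et' ph' =
  pack (fun i => de i + de' i) (fun i => om i + om' i) (V + V') (et + et')
    (ph + ph') :> 'cV[R]_(state_dim d).
Proof. by rewrite /pack mxcolD mxcolD !add_col_mx. Qed.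

Lemma is_mulmx_delta_of i : is_mulmx (fun x => delta_of x i).
Proof. exact/is_mulmx_submxcol/is_mulmx_usub/is_mulmx_id. Qed.

Lemma is_mulmx_omega_of i : is_mulmx (fun x => omega_of x i).
Proof. exact/is_mulmx_submxcol/is_mulmx_usub/is_mulmx_dsub/is_mulmx_id. Qed.

Lemma is_mulmx_V_of : is_mulmx (fun x => V_of x).
Proof. exact/is_mulmx_usub/is_mulmx_dsub/is_mulmx_dsub/is_mulmx_id. Qed.

Lemma is_mulmx_eta_of : is_mulmx (fun x => eta_of x).
Proof. exact/is_mulmx_usub/is_mulmx_dsub/is_mulmx_dsub/is_mulmx_dsub/is_mulmx_id. Qed.

Lemma is_mulmx_phi_of : is_mulmx (fun x => phi_of x).
Proof. exact/is_mulmx_dsub/is_mulmx_dsub/is_mulmx_dsub/is_mulmx_dsub/is_mulmx_id. Qed.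

Lemma is_mulmx_omega_tilde : is_mulmx (fun x => omega_tilde x).
Proof.
have -> : (fun x => omega_tilde x) =
    fun x => \sum_i (1 * omega_of x i ord0 0) *: (unit_vec i : 'cV[R]_N.+1).
  apply/funext => x; rewrite /omega_tilde -col_sum_unit_vec.
  by apply: eq_bigr => i _; rewrite mul1r.
apply: is_mulmx_sum => i; exact/is_mulmx_scale_coord/is_mulmx_omega_of.
Qed.

End State.

(** * The storage function and its rate of change *)

Section Storage.
Variables (R : realType) (N : nat) (d : 'I_N.+1 -> nat) (H : hvdc R d).
Variables (k_phi gamma : R).
Implicit Types (x y : 'cV[R]_(state_dim d)).

(** The bracket in [omega_dot] without the constant [Pm]. *)
Definition omega_lin x i : 'cV[R]_(d i).+1 :=
  - (Kdroop H i + Komega_mx H i) *m omega_of x i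
  + (KVgain H i * V_of x i 0) *: unit_vec ord0
  - L_AC H i *m Sac H i *m delta_of x i
  - (KVgain H i / Komega H i * eta_of x i 0) *: (KdroopI H i *m ones (d i).+1)
  - unit_vec ord0 *m (unit_vec i)^T *m L_phi H *m Smx H *m phi_of x.

Definition closed_loop_lin x : 'cV[R]_(state_dim d) :=
  pack (delta_dot H x) (fun i => Mmx H i *m omega_lin x i) (V_dot H x)
    (eta_dot H x) (phi_dot H gamma x).

Lemma closed_loop_affine x : closed_loop H gamma x =
  closed_loop_lin x + pack (fun=> 0) (fun i => Mmx H i *m Pm H i) 0 0 0.
Proof.
rewrite packD !addr0 /closed_loop /pack; congr col_mx.
  by apply: eq_mxcol => i; rewrite addr0.
by congr col_mx; apply: eq_mxcol => i; rewrite -mulmxDr.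
Qed.

Lemma is_mulmx_closed_loop_lin : is_mulmx closed_loop_lin.
Proof.
have hd := is_mulmx_delta_of; have ho := is_mulmx_omega_of.
have hV := is_mulmx_V_of; have he := is_mulmx_eta_of.
have hp := is_mulmx_phi_of; have ht := is_mulmx_omega_tilde.
apply: is_mulmx_col.
  apply: is_mulmx_mxcol => i; exact/is_mulmxM/ho.
apply: is_mulmx_col.
  apply: is_mulmx_mxcol => i; apply: is_mulmxM.
  do 4?apply: is_mulmxD.
  - exact/is_mulmxM/ho.
  - exact/is_mulmx_scale_coord/hV.
  - exact/is_mulmxN/is_mulmxM/hd.
  - exact/is_mulmxN/is_mulmx_scale_coord/he.
  - exact/is_mulmxN/is_mulmxM/hp.
apply: is_mulmx_col.
  do 2?apply: is_mulmxD.
  - exact/is_mulmxZ/is_mulmxM/ht.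
  - exact/is_mulmxN/is_mulmxM/hV.
  - exact/is_mulmxZ/is_mulmxM/hp.
apply: is_mulmx_col.
  apply: is_mulmxD; last exact/is_mulmxN/is_mulmxM/he.
  apply: is_mulmx_sum => i; exact/is_mulmxM/ho.
apply: is_mulmxD; first exact/is_mulmxM/ht.
exact/is_mulmxN/is_mulmxZ/hp.
Qed.

(** With this weight the gain [KVgain / Komega] of [eta] in the frequency equation becomes 1,
    cancelling the input of [eta_dot], and the [L_phi] term matches the input of [phi_dot]. *)
Definition omega_weight i : R := Komega H i / KVgain H i.
Local Notation b := omega_weight.

(** Polarised: at [(x, x)] it is the storage function, and at [(x, closed_loop_lin x)] half its rate
    of change along the homogeneous system. *)
Definition storage eps x y : R :=
  \sum_i b i * (dot (diag_of (inertia H i) *m omega_of x i) (omega_of y i)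
     + dot (Sac H i *m delta_of x i) (L_AC H i *m (Sac H i *m delta_of y i)))
  + Vnom H * dot (diag_of (capacitance H) *m V_of x) (V_of y)
  + dot (eta_of x) (eta_of y)
  + dot (Smx H *m phi_of x) (L_phi H *m (Smx H *m phi_of y))
  + eps * dot (phi_of x) (phi_of y).

Lemma is_bilinear_storage eps : is_bilinear_mx (storage eps).
Proof.
do 4?apply: is_bilinear_mxD.
- apply: is_bilinear_mx_sum => i; apply: is_bilinear_mxZ; apply: is_bilinear_mxD.
    by apply: is_bilinear_mx_dot; [apply: is_mulmxM|]; exact: is_mulmx_omega_of.
  apply: is_bilinear_mx_dot; last apply: is_mulmxM; apply: is_mulmxM;
  exact: is_mulmx_delta_of.
- apply/is_bilinear_mxZ/is_bilinear_mx_dot; first apply: is_mulmxM;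
  exact: is_mulmx_V_of.
- by apply: is_bilinear_mx_dot; exact: is_mulmx_eta_of.
- apply: is_bilinear_mx_dot; last apply: is_mulmxM; apply: is_mulmxM;
  exact: is_mulmx_phi_of.
- by apply/is_bilinear_mxZ/is_bilinear_mx_dot; exact: is_mulmx_phi_of.
Qed.

Let symAC i := laplacian_sym (ac_graph H i).
Let symphi := laplacian_sym (phi_graph H).

Lemma storageC eps x y : storage eps x y = storage eps y x.
Proof.
rewrite /storage (dotC (phi_of x)) (dotC (eta_of x)) (dot_diag_sym _ (V_of x)).
rewrite (dot_sym_mx _ _ symphi); do 4!congr (_ + _).
by apply: eq_bigr => i _; rewrite dot_diag_sym (dot_sym_mx _ _ (symAC i)).
Qed.

Lemma omega_weight_gt0 i : 0 < b i.
Proof. by rewrite divr_gt0 ?Komega_gt0 ?KVgain_gt0. Qed.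

(** The input of [phi_dot] before projection by [(Smx H)^T]. *)
Definition phi_input x : 'cV[R]_N.+1 := \col_i (b i * omega_of x i ord0 0).

Lemma phi_inputE x : invmx (KV H) *m Komega_tilde H *m omega_tilde x = phi_input x.
Proof.
have unitK : KV H \in unitmx.
  apply: unitmx_of_ker0 => u Ku; apply: (qform_diag_eq0 (KVgain_gt0 H)).
  by rewrite /qform -/(KV H) Ku dot0r.
suff e : KV H *m phi_input x = Komega_tilde H *m omega_tilde x.
  by rewrite -mulmxA -e mulKmx.
apply/colP => i; rewrite !diag_of_mulE [phi_input x _ _]mxE [omega_tilde x _ _]mxE.
by rewrite /omega_weight; field; rewrite gt_eqF ?KVgain_gt0.
Qed.

Definition dissipation eps x : R :=
  \sum_i b i * qform (Kdroop H i) (omega_of x i)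
  + \sum_i (Komega H i * omega_of x i ord0 0 - KVgain H i * V_of x i 0) ^+ 2
      / KVgain H i
  + (Vnom H * qform (L_R H) (V_of x) - dot (V_of x) (L_phi H *m (Smx H *m phi_of x))
     + gamma * qform (L_phi H) (Smx H *m phi_of x))
  + qform (L_eta H) (eta_of x)
  + eps * (gamma * dot (phi_of x) (phi_of x)
           - dot (Smx H *m phi_of x) (phi_input x)).

Lemma omega_storage_rate x i :
  b i * dot (diag_of (inertia H i) *m omega_of x i) (Mmx H i *m omega_lin x i) =
  - (b i * qform (Kdroop H i) (omega_of x i))
  - b i * Komega H i * omega_of x i ord0 0 ^+ 2
  + Komega H i * (V_of x i 0 * omega_of x i ord0 0)
  - b i * dot (omega_of x i) (L_AC H i *m (Sac H i *m delta_of x i))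
  - eta_of x i 0 * dot (KdroopI H i *m ones _) (omega_of x i)
  - b i * omega_of x i ord0 0 * (L_phi H *m (Smx H *m phi_of x)) i 0.
Proof.
have Kw := gt_eqF (Komega_gt0 H i); have Kv := gt_eqF (KVgain_gt0 H i).
rewrite /omega_lin dot_diag_diagV; last exact: inertia_gt0.
have -> : unit_vec ord0 *m (unit_vec i)^T *m L_phi H *m Smx H *m phi_of x =
    (L_phi H *m (Smx H *m phi_of x)) i 0 *: (unit_vec ord0 : 'cV[R]_(d i).+1).
  by rewrite -mul_unit_vec_tr !mulmxA.
rewrite mulNmx mulmxDl !(dotDr, dotNr, dotZr) !dot_unit_vec -/(qform _ _).
rewrite [dot _ (Komega_mx H i *m _)]dot_diag big_ord_recl /= big1 ?addr0; last first.
  by move=> k _; rewrite mul0r.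
rewrite (dotC _ (omega_of x i)) -!mulmxA /omega_weight.
by field; rewrite Kw Kv.
Qed.

(** The stiffness, [eta] and [L_phi] couplings cancel between the equations; the projections [S S^T]
    disappear because the Laplacians annihilate [ones]. The two copies of the [omega]-[V] coupling
    complete a square with the [Komega] and [KVgain] damping. *)
Lemma storage_rate eps x : storage eps x (closed_loop_lin x) = - dissipation eps x.
Proof.
have V0 := gt_eqF (Vnom_gt0 H).
rewrite /storage /closed_loop_lin !pack_ofE.
set z := Smx H *m phi_of x; set p := L_phi H *m z.
have S_mul_tr (L : 'M[R]_N.+1) (u : 'cV[R]_N.+1) : L *m ones _ = 0 ->
    L *m (Smx H *m ((Smx H)^T *m u)) = L *m u.
  by move=> L1; rewrite !mulmxA orthogonal_extend_mul_tr //; exact: Smx_orthogonal.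
have -> : dot (phi_of x) (phi_dot H gamma x) =
    dot z (phi_input x) - gamma * dot (phi_of x) (phi_of x).
  rewrite /phi_dot -!mulmxA [invmx _ *m _]mulmxA phi_inputE dotDr dotNr dotZr.
  by rewrite dot_mulmxr trmxK.
have -> : dot z (L_phi H *m (Smx H *m phi_dot H gamma x)) =
    \sum_i b i * omega_of x i ord0 0 * p i 0 - gamma * qform (L_phi H) z.
  rewrite /phi_dot -!mulmxA [invmx _ *m _]mulmxA phi_inputE.
  rewrite !mulmxDr !mulmxN dotDr dotNr -!scalemxAr dotZr -/z.
  rewrite S_mul_tr; last exact: laplacian_ones (phi_graph H).
  rewrite (dot_sym_mx _ _ symphi) -/p; congr (_ - _).
  by apply: eq_bigr => i _; rewrite mxE.
have -> : dot (eta_of x) (eta_dot H x) =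
    \sum_i eta_of x i 0 * dot (KdroopI H i *m ones _) (omega_of x i)
    - qform (L_eta H) (eta_of x).
  rewrite /eta_dot dotDr dotNr; congr (_ - _).
  rewrite (big_morph (dot (eta_of x)) (fun u v => dotDr u v _) (dot0r _)).
  apply: eq_bigr => i _.
  have -> : unit_vec i *m (ones (d i).+1)^T *m KdroopI H i =
      unit_vec i *m (KdroopI H i *m ones (d i).+1)^T.
    by rewrite trmx_mul tr_diag_mx mulmxA.
  by rewrite mul_unit_vec_l dotZr dot_unit_vec mulrC.
have -> : Vnom H * dot (diag_of (capacitance H) *m V_of x) (V_dot H x) =
    \sum_i Komega H i * (V_of x i 0 * omega_of x i ord0 0)
    - Vnom H * qform (L_R H) (V_of x) - \sum_i KVgain H i * (V_of x i 0 * V_of x i 0)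
    + dot (V_of x) p.
  rewrite /V_dot -!mulmxA -/z -/p !(dotDr, dotNr, dotZr) /Emx.
  rewrite !dot_diag_diagV; try exact: capacitance_gt0.
  rewrite mulmxDl -scalemxAl dotDr dotZr !dot_diag -/(qform _ _).
  rewrite [X in _^-1 * X](eq_bigr
    (fun i => Komega H i * (V_of x i 0 * omega_of x i ord0 0))).
    by field; rewrite V0.
  by move=> i _; rewrite [omega_tilde x _ _]mxE.
(* The first two summands are opposite to terms of the [V] rate above; borrowing them here makes the
   square appear for each converter. *)
have key i : b i *
    (dot (diag_of (inertia H i) *m omega_of x i) (Mmx H i *m omega_lin x i)
     + dot (Sac H i *m delta_of x i) (L_AC H i *m (Sac H i *m delta_dot H x i))) =
  Komega H i * (V_of x i 0 * omega_of x i ord0 0) * -1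
  + KVgain H i * (V_of x i 0 * V_of x i 0)
  - eta_of x i 0 * dot (KdroopI H i *m ones _) (omega_of x i)
  - b i * omega_of x i ord0 0 * p i 0
  - b i * qform (Kdroop H i) (omega_of x i)
  - (Komega H i * omega_of x i ord0 0 - KVgain H i * V_of x i 0) ^+ 2
      / KVgain H i.
  have Kv := gt_eqF (KVgain_gt0 H i).
  rewrite mulrDr omega_storage_rate /delta_dot -/z -/p.
  have -> : L_AC H i *m (Sac H i *m ((Sac H i)^T *m omega_of x i)) =
      L_AC H i *m omega_of x i.
    rewrite !mulmxA orthogonal_extend_mul_tr //; first exact: Sac_orthogonal.
    exact: laplacian_ones (ac_graph H i).
  rewrite (dot_sym_mx _ _ (symAC i)) /omega_weight.
  by field; rewrite Kv.
rewrite (eq_bigr _ (fun i _ => etrans _ (key i))); last first.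
  by move=> i _; rewrite !pack_ofE.
rewrite !big_split /= !sumrN -mulr_suml /dissipation -/z -/p.
by ring.
Qed.

End Storage.

(** * Definiteness, dissipation and observability *)

Section Positivity.
Variables (R : realType) (N : nat) (d : 'I_N.+1 -> nat) (H : hvdc R d).
Variables (k_phi gamma : R).
Implicit Types (x y : 'cV[R]_(state_dim d)).
Local Notation b := (omega_weight H).
Let b_gt0 := omega_weight_gt0 H.

Lemma dc_graph_inv : weighted_graph (dc_edge H) (fun i j => (resistance H i j)^-1).
Proof.
have [esym eirr hw] := dc_graph H; split=> // i j /hw[w0 wC].
by split; rewrite ?invr_gt0 // wC.
Qed.

Lemma Sac_stiffness_eq0 i (u : 'cV[R]_(d i)) :
  dot (Sac H i *m u) (L_AC H i *m (Sac H i *m u)) = 0 -> u = 0.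
Proof.
move=> /(laplacian_qform0_const (ac_graph H i) (ac_connected H i)).
exact/orthogonal_extend_const/Sac_orthogonal.
Qed.

Lemma dot_Smx u : dot (Smx H *m u) (Smx H *m u) = dot u u.
Proof.
rewrite dot_mulmxl mulmxA (orthogonal_extend_tr_mul (Smx_orthogonal H)).
by rewrite mul1mx.
Qed.

(** All summands are nonnegative, so a nonpositive total makes each vanish. Connectedness of the AC
    grids then gives [delta = 0], and the [eps] term gives [phi = 0]. *)
Lemma storage_gt0 eps x : 0 < eps -> x != 0 -> 0 < storage H eps x x.
Proof.
move=> e0; apply: contra_neqT; rewrite -leNgt => hle.
have hw i : 0 <= qform (diag_of (inertia H i)) (omega_of x i).
  exact/qform_diag_ge0/inertia_gt0.
have hd i := laplacian_qform_ge0 (ac_graph H i) (Sac H i *m delta_of x i).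
have hV := qform_diag_ge0 (V_of x) (capacitance_gt0 H).
have he := dot_ge0 (eta_of x).
have hp := laplacian_qform_ge0 (phi_graph H) (Smx H *m phi_of x).
have hf := dot_ge0 (phi_of x).
pose r i := b i * (qform (diag_of (inertia H i)) (omega_of x i) +
    qform (L_AC H i) (Sac H i *m delta_of x i)).
have hs i : 0 <= r i.
  by rewrite mulr_ge0 ?(ltW (b_gt0 i)) ?addr_ge0 // hd.
move: hle; rewrite /storage (eq_bigr r); last by move=> i _; rewrite dotC.
rewrite [dot (diag_of _ *m V_of x) _]dotC -/(qform _ _) -/(qform (L_phi H) _).
have hS : 0 <= \sum_i r i by exact: sumr_ge0.
have hVV : 0 <= Vnom H * qform (diag_of (capacitance H)) (V_of x).
  by rewrite mulr_ge0 // ltW // Vnom_gt0.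
have hff : 0 <= eps * dot (phi_of x) (phi_of x) by rewrite mulr_ge0 // ltW.
rewrite -/(L_phi H) in hp; move=> hle.
have z1 : \sum_i r i = 0 by apply: le_anti; lra.
have z2 : Vnom H * qform (diag_of (capacitance H)) (V_of x) = 0.
  by apply: le_anti; lra.
have z3 : dot (eta_of x) (eta_of x) = 0 by apply: le_anti; lra.
have z4 : eps * dot (phi_of x) (phi_of x) = 0 by apply: le_anti; lra.
have z1i i : qform (diag_of (inertia H i)) (omega_of x i) = 0 /\
    qform (L_AC H i) (Sac H i *m delta_of x i) = 0.
  have := psumr_eq0P (fun j _ => hs j) z1 => /(_ i isT) /eqP.
  rewrite mulf_eq0 gt_eqF //= => /eqP; have := hw i; have := hd i.
  by rewrite -/(L_AC H i) => p q h; split; lra.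
apply: state_eq0.
- by move=> i; have [_] := z1i i; exact: Sac_stiffness_eq0.
- by move=> i; have [+ _] := z1i i; apply: qform_diag_eq0; exact: inertia_gt0.
- apply: (qform_diag_eq0 (capacitance_gt0 H)); move/eqP: z2.
  by rewrite mulf_eq0 gt_eqF ?Vnom_gt0 //= => /eqP.
- exact: dot_eq0.
by apply: dot_eq0; move/eqP: z4; rewrite mulf_eq0 gt_eqF //= => /eqP.
Qed.

Hypothesis hL : L_phi H = k_phi *: L_R H.
Hypothesis k_phi_ge0 : 0 <= k_phi.
Hypothesis hgamma : k_phi / (4 * Vnom H) < gamma.

Let gamma_gt0 : 0 < gamma.
Proof.
apply: le_lt_trans hgamma; rewrite divr_ge0 // mulr_ge0 // ltW // Vnom_gt0 //.
Qed.

(* Completing the square: the form is [(2 Vnom v - k_phi z)^T L_R (2 Vnom v -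
   k_phi z) / (4 Vnom)] plus a nonnegative multiple of [z^T L_R z]. *)
Lemma coupling_ge0 v z :
  0 <= Vnom H * qform (L_R H) v - dot v (L_phi H *m z) + gamma * qform (L_phi H) z.
Proof.
have V0 := Vnom_gt0 H; have psd := laplacian_qform_ge0 dc_graph_inv.
have symR := laplacian_sym dc_graph_inv.
have := psd ((2 * Vnom H) *: v - k_phi *: z); have := psd z.
rewrite -/(L_R H) /qform mulmxBr -!scalemxAr 
  !(dotDl, dotDr, dotNl, dotNr, dotZl, dotZr).
rewrite (dot_sym_mx z v symR) hL -!scalemxAl !dotZr.
set p := dot v _; set q := dot z _; set r := dot v _ => q0 h.
have h1 : k_phi ^+ 2 * q <= gamma * k_phi * (4 * Vnom H) * q.
  have h0 : k_phi <= gamma * (4 * Vnom H) by rewrite -ler_pdivrMr ?mulr_gt0 // ltW.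
  by rewrite ler_wpM2r //; have := ler_wpM2l k_phi_ge0 h0; lra.
have V4 : 0 < 4 * Vnom H by rewrite mulr_gt0.
by rewrite -(pmulr_rge0 _ V4); lra.
Qed.

(** Young's inequality with parameter [gamma] splits the cross term between half of the droop, by
    the smallness of [eps], and half of [eps * gamma * |phi|^2], as [Smx] is an isometry. *)
Lemma dissipation_ge eps x : 0 < eps ->
  (forall i, eps * b i <= gamma * droop H i ord0) ->
  2^-1 * \sum_i b i * qform (Kdroop H i) (omega_of x i)
  + \sum_i (Komega H i * omega_of x i ord0 0 - KVgain H i * V_of x i 0) ^+ 2
      / KVgain H i
  + eps * gamma / 2 * dot (phi_of x) (phi_of x) <= dissipation H gamma eps x.
Proof.
move=> e0 heps; rewrite /dissipation.
have h1 := coupling_ge0 (V_of x) (Smx H *m phi_of x).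
have h2 := laplacian_qform_ge0 (eta_graph H) (eta_of x); rewrite -/(L_eta H) in h2.
have h3 := young_dot (phi_input H x) (Smx H *m phi_of x) gamma_gt0.
rewrite dot_Smx (dotC (phi_input H x)) in h3.
have h4 := ler_norm (dot (Smx H *m phi_of x) (phi_input H x)).
have h5 : eps * (gamma^-1 * dot (phi_input H x) (phi_input H x)) <=
    \sum_i b i * qform (Kdroop H i) (omega_of x i).
  rewrite mulrA /dot mulr_sumr; apply: ler_sum => i _.
  rewrite [phi_input H x _ _]mxE.
  have -> : eps / gamma * (b i * omega_of x i ord0 0 * (b i * omega_of x i ord0 0)) =
      b i * ((eps * b i / gamma) * omega_of x i ord0 0 ^+ 2) by ring.
  rewrite ler_pM2l //; apply: le_trans (qform_diag_ge _ ord0 (droop_gt0 H i)).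
  by rewrite ler_wpM2r ?sqr_ge0 // ler_pdivrMr // [leRHS]mulrC.
have h6 : eps * (2 * dot (Smx H *m phi_of x) (phi_input H x)) <=
   eps * (gamma^-1 * dot (phi_input H x) (phi_input H x)
          + gamma * dot (phi_of x) (phi_of x)).
  by rewrite ler_pM2l //; lra.
lra.
Qed.

Lemma dissipation_terms_ge0 x :
  [/\ forall i, 0 <= b i * qform (Kdroop H i) (omega_of x i),
      forall i, 0 <= (Komega H i * omega_of x i ord0 0 - KVgain H i * V_of x i 0) ^+ 2
      / KVgain H i &
      0 <= dot (phi_of x) (phi_of x)].
Proof.
split; last exact: dot_ge0.
  by move=> i; rewrite mulr_ge0 ?(ltW (b_gt0 i)) //; exact/qform_diag_ge0/droop_gt0.
by move=> i; rewrite divr_ge0 ?sqr_ge0 // ltW // KVgain_gt0.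
Qed.

Lemma dissipation_ge0 eps x : 0 < eps ->
  (forall i, eps * b i <= gamma * droop H i ord0) -> 0 <= dissipation H gamma eps x.
Proof.
move=> e0 heps; have [h1 h2 h3] := dissipation_terms_ge0 x.
apply: le_trans (dissipation_ge _ e0 heps).
apply: addr_ge0; last by rewrite mulr_ge0 // ltW // divr_gt0 // mulr_gt0.
by apply: addr_ge0; [rewrite mulr_ge0 // sumr_ge0 | exact: sumr_ge0].
Qed.

Lemma dissipation_eq0 eps x : 0 < eps ->
  (forall i, eps * b i <= gamma * droop H i ord0) -> dissipation H gamma eps x = 0 ->
  [/\ forall i, omega_of x i = 0, V_of x = 0 & phi_of x = 0].
Proof.
move=> e0 heps d0; have [h1 h2 h3] := dissipation_terms_ge0 x.
have := dissipation_ge x e0 heps; rewrite d0.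
set s1 := \sum_i _; set s2 := \sum_i _ => hle.
have s20 : 0 <= s2 by exact: sumr_ge0.
have s10 : 0 <= s1 by exact: sumr_ge0.
have eg : 0 < eps * gamma / 2 by rewrite divr_gt0 ?mulr_gt0.
have h3' : 0 <= eps * gamma / 2 * dot (phi_of x) (phi_of x).
  by rewrite mulr_ge0 // ltW.
have z1 : s1 = 0 by apply: le_anti; lra.
have z2 : s2 = 0 by apply: le_anti; lra.
have z3 : eps * gamma / 2 * dot (phi_of x) (phi_of x) = 0 by apply: le_anti; lra.
have om i : omega_of x i = 0.
  have /eqP := psumr_eq0P (fun j _ => h1 j) z1 (i := i) isT.
  rewrite mulf_eq0 gt_eqF //= => /eqP; apply: qform_diag_eq0; exact: droop_gt0.
split=> //.
  (* With [omega = 0] the mismatch reduces to [KVgain H i * V], up to sign. *)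
  apply/colP => i; have /eqP := psumr_eq0P (fun j _ => h2 j) z2 (i := i) isT.
  rewrite om mulf_eq0 invr_eq0 (gt_eqF (KVgain_gt0 H i)) orbF sqrf_eq0.
  rewrite !mxE mulr0 sub0r oppr_eq0 mulf_eq0 (gt_eqF (KVgain_gt0 H i)) /=.
  by move/eqP.
by apply: dot_eq0; move/eqP: z3; rewrite mulf_eq0 gt_eqF //= => /eqP.
Qed.

(** Zero acceleration leaves a balance between AC stiffness and integral action. Pairing it with
    [ones] removes the Laplacian and leaves [eta] times a positive number; then the stiffness term
    vanishes, hence [delta]. *)
Lemma observable x : (forall i, omega_of x i = 0) -> V_of x = 0 -> phi_of x = 0 ->
  (forall i, omega_of (closed_loop_lin H gamma x) i = 0) -> x = 0.
Proof.
move=> w0 V0 p0 dw0.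
have bal i : L_AC H i *m (Sac H i *m delta_of x i) =
    - ((KVgain H i / Komega H i * eta_of x i 0) *: (KdroopI H i *m ones (d i).+1)).
  have := dw0 i; rewrite omega_of_pack => Mr.
  have : omega_lin H x i = 0.
    apply/dot_eq0; rewrite -(dot_diag_diagV _ _ (inertia_gt0 H i)).
    by rewrite -/(Mmx H i) Mr dot0r.
  rewrite /omega_lin w0 V0 p0 !mulmx0 mxE mulr0 scale0r addr0 subr0 add0r -mulmxA.
  by move/eqP; rewrite subr_eq0 => /eqP <-; rewrite opprK.
have eta0 i : eta_of x i 0 = 0.
  have := congr1 (dot (ones _)) (bal i).
  rewrite dotNr dotZr dot_mulmxr (laplacian_sym (ac_graph H i)) -/(L_AC H i).
  rewrite (laplacian_ones (ac_graph H i)) dot0l => /eqP.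
  have ones_gt0 : 0 < dot (ones _) (KdroopI H i *m ones (d i).+1).
    rewrite dot_diag (bigD1 ord0) //= !mxE !mulr1 ltr_wpDr ?droopI_gt0 //.
    by apply: sumr_ge0 => k _; rewrite !mxE !mulr1 ltW // droopI_gt0.
  rewrite eq_sym oppr_eq0 mulf_eq0 (gt_eqF ones_gt0) orbF mulf_eq0 gt_eqF /=.
    by move/eqP.
  by rewrite divr_gt0 ?KVgain_gt0 ?Komega_gt0.
apply: state_eq0 => //; last by apply/colP => i; rewrite eta0 mxE.
by move=> i; apply: Sac_stiffness_eq0; rewrite bal eta0 mulr0 scale0r oppr0 dot0r.
Qed.

Lemma closed_loop_gas : exists xe : 'cV[R]_(state_dim d),
  unique (equilibrium (closed_loop H gamma)) xe /\
  globally_asymptotically_stable (closed_loop H gamma) xe.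
Proof.
(* The sum dominates each ratio [b i / droop H i ord0], so [eps = gamma / s] meets all the smallness
   conditions at once. *)
pose s := 1 + \sum_i b i / droop H i ord0.
have hbd i : 0 <= b i / droop H i ord0 by rewrite divr_ge0 // ltW ?droop_gt0.
have s0 : 0 < s by rewrite ltr_wpDr ?sumr_ge0.
pose eps := gamma / s; have e0 : 0 < eps by rewrite divr_gt0.
have heps i : eps * b i <= gamma * droop H i ord0.
  rewrite /eps -mulrA ler_pM2l // ler_pdivrMl // -ler_pdivrMr ?droop_gt0 //.
  rewrite /s (bigD1 i) //= addrCA lerDl addr_ge0 ?sumr_ge0 //.
have [A hA] := is_mulmx_closed_loop_lin H gamma.
have [P hP] := is_bilinear_storage H eps.
have rate x : dot (P *m x) (A *m x) = - dissipation H gamma eps x.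
  by rewrite -hA -hP storage_rate.
apply: (@affine_lyapunov_gas _ _ _ A P).
- by move=> x; rewrite closed_loop_affine hA.
- by apply: bilinear_mx_sym => x y; rewrite -!hP storageC.
- by move=> x x0; rewrite /qform dotC -hP storage_gt0.
- by move=> x; rewrite rate oppr_le0 dissipation_ge0.
move=> x; rewrite !rate => /eqP; rewrite oppr_eq0 => /eqP d0.
move=> /eqP; rewrite oppr_eq0 => /eqP d1.
have [w0 V0 p0] := dissipation_eq0 e0 heps d0.
have [dw0 _ _] := dissipation_eq0 e0 heps d1.
by apply: observable => // i; rewrite hA dw0.
Qed.

End Positivity.

(** A negative [k_phi] would make the [L_R] form vanish at a unit vector, which is not constant when
    there are at least two converters. *)
Lemma k_phi_ge0 (R : realType) (N : nat) (d : 'I_N.+1 -> nat) (H : hvdc R d)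
    (k_phi : R) : (0 < N)%N -> L_phi H = k_phi *: L_R H -> 0 <= k_phi.
Proof.
move=> N0 hL; rewrite leNgt; apply/negP => k0.
pose u : 'cV[R]_N.+1 := unit_vec ord0.
have h1 := laplacian_qform_ge0 (dc_graph_inv H) u.
have h2 := laplacian_qform_ge0 (phi_graph H) u.
have : qform (L_R H) u = 0.
  apply: le_anti; rewrite h1 andbT -(nmulr_rge0 _ k0) -qform_scale -hL //.
move=> /(laplacian_qform0_const (dc_graph_inv H) (dc_connected H)).
move=> /(_ ord0 (Ordinal (N0 : 1 < N.+1)%N)) /eqP.
by rewrite !mxE eqxx /= oner_eq0.
Qed.

Theorem theorem4 (R : realType) (N : nat) (d : 'I_N.+1 -> nat)
    (H : hvdc R d) (k_phi gamma : R)
    (hL : L_phi H = k_phi *: L_R H)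
    (hgamma : k_phi / (4%:R * Vnom H) < gamma) :
  exists xe : 'cV[R]_(state_dim d),
    unique (equilibrium (closed_loop H gamma)) xe /\
    globally_asymptotically_stable (closed_loop H gamma) xe.
Proof.
(* With a single converter k_phi is unconstrained and gamma may be nonpositive,
   but then L_phi = 0 and phi'' is empty. *)
have [N0|N_gt0] := posnP N; last first.
  exact: closed_loop_gas hL (k_phi_ge0 N_gt0 hL) hgamma.
have empty (i : 'I_N) : False by have := leq_trans (ltn_ord i) (eq_leq N0).
(* A graph on one vertex has no edge, by irreflexivity. *)
have L0 (e : rel 'I_N.+1) (w : 'I_N.+1 -> 'I_N.+1 -> R) :
    weighted_graph e w -> laplacian e w = 0.
  have is0 (i : 'I_N.+1) : i = 0 :> nat.
    apply/eqP; rewrite -leqn0.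
    exact: leq_trans (ltn_ord i) (eq_leq (congr1 S N0)).
  have one (i j : 'I_N.+1) : i = j by apply: val_inj; rewrite /= !is0.
  move=> gw.
  apply/matrixP => i j; rewrite !mxE (one i j) eqxx big1 // => k.
  by rewrite (one j k); have [_ -> _] := gw.
have -> : closed_loop H gamma = closed_loop H 1.
  apply/funext => x; rewrite /closed_loop; congr pack.
  by apply/colP => i; case: (empty i).
apply: (@closed_loop_gas _ _ _ _ 0) => //; last by rewrite mul0r.
by rewrite scale0r; exact: L0 (phi_graph H).
Qed.
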